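(* Let $h>0$ and let $\lambda,\mu\in\mathbb{R}$ satisfy $\mu>0$, $\lambda+\mu>0$. The eigenvalues of the free-Dirichlet (FD) eigenvalue problem for the operator of linear elasticity on the flat two-dimensional cylinder $M=\mathbb{T}\times[0,h]$ are: (i) $\frac{k^2\pi^2}{h^2}(\lambda+2\mu)$, $k=1,2,\dots$, with multiplicity $1$; (ii) $\frac{k^2\pi^2}{h^2}\mu$, $k=1,2,\dots$, with multiplicity $1$; (iii) $\left(n^2+\frac{k^2\pi^2}{h^2}\right)\mu$, $n,k=1,2,\dots$, with multiplicity $2$; (iv) $n^2(\lambda+2\mu)$, $n=1,2,\dots$, with multiplicity $2$; (v) $\left(n^2+\frac{k^2\pi^2}{h^2}\right)(\lambda+2\mu)$, $n,k=1,2,\dots$, with multiplicity $2$.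
   Context: $\mathbb{T}=\mathbb{R}/2\pi\mathbb{Z}$ is the one-dimensional torus; $M$ has coordinates $(x^1,x^2)\in[0,2\pi)\times[0,h]$ and the flat metric, with boundary $\partial M=\{x^2=0\}\cup\{x^2=h\}$. The operator of linear elasticity acts on vector fields $\mathbf{u}=(u_1,u_2)$ by $\mathcal{L}\mathbf{u}=-\mu\Delta\mathbf{u}-(\lambda+\mu)\operatorname{grad}\operatorname{div}\mathbf{u}$ ($\Delta=\partial_1^2+\partial_2^2$ acting componentwise). With $\mathbf{n}$ the exterior unit normal to $\partial M$, the boundary traction operator is $(\mathcal{T}\mathbf{u})_\alpha=\lambda n_\alpha\partial_\beta u_\beta+\mu(n_\beta\partial_\beta u_\alpha+n_\beta\partial_\alpha u_\beta)$ (summation over $\beta$). The FD eigenvalue problem is: find $\mathbf{u}\in H^1(M)$, $\mathbf{u}\neq0$, and $\Lambda\in\mathbb{R}$ with $\mathcal{L}\mathbf{u}=\Lambda\mathbf{u}$ in $M$, subject to $\mathcal{T}\mathbf{u}-(\mathbf{n}\cdot\mathcal{T}\mathbf{u})\mathbf{n}=0$ and $\mathbf{n}\cdot\mathbf{u}=0$ on $\partial M$. Eigenvalues are enumerated with account of multiplicity; when values from the listed series coincide, their multiplicities add.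
   Formalization: The listed series omit the eigenvalue 0, which occurs (constant field u=(1,0) satisfies all conditions); the formal theorem asserts the list for all nonzero eigenvalues and adds that 0 is an eigenvalue of multiplicity 1. *)

(* Defs.v *)
From HB Require Import structures.
From mathcomp Require Import all_boot all_order all_algebra.
From mathcomp Require Import all_classical all_reals all_analysis.
Import Order.TTheory GRing.Theory Num.Theory.
Import numFieldNormedType.Exports.

Set Implicit Arguments.
Unset Strict Implicit.
Unset Printing Implicit Defensive.

Local Open Scope classical_set_scope.
Local Open Scope card_scope.
Local Open Scope ring_scope.

Section Defs.
Context {R : realType}.

Definition lebesgue2 : {measure set (measurableTypeR R * measurableTypeR R) -> \bar R} :=
  (lebesgue_measure \x lebesgue_measure)%E.

(* Functions and vector fields on the cylinder are given by their values at
   the points of [cylinder h], the range of the coordinates (x^1, x^2). The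
   identification of x^1 = 0 with x^1 = 2 pi is carried by the test functions,
   which are 2 pi-periodic in x^1. *)
Definition cylinder (h : R) : set (R * R) := `[0, 2 * pi[ `*` `[0, h].

Definition vfield := 'I_2 -> R * R -> R.

Definition cyl_integral (h : R) (f : R * R -> R) : R :=
  (\int[lebesgue2]_(x in cylinder h) f x)%R.

Definition square_integrable (h : R) (f : R * R -> R) : Prop :=
  measurable_fun (cylinder h) (f : measurableTypeR R * measurableTypeR R -> R) /\
  lebesgue2.-integrable (cylinder h) (fun x => ((f x) ^+ 2)%:E).

Definition ae_eq_vfield (h : R) (u v : vfield) : Prop :=
  forall a : 'I_2, ae_eq lebesgue2 (cylinder h) (u a) (v a).

Definition basis_vec (b : 'I_2) : R * R := if b == 0 then (1, 0) else (0, 1).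

Definition partial (b : 'I_2) (f : R * R -> R) : R * R -> R :=
  fun x => 'D_(basis_vec b) f x.

Definition smooth (f : R * R -> R) : Prop :=
  forall s : seq 'I_2,
    continuous (foldr partial f s) /\
    forall (b : 'I_2) (x : R * R), derivable (foldr partial f s) x (basis_vec b).

(* Restrictions to the cylinder of smooth functions on T x R; all functions
   smooth up to the boundary are of this form. *)
Definition smooth_cyl (f : R * R -> R) : Prop :=
  smooth f /\ forall x y : R, f (x + 2 * pi, y) = f (x, y).

Definition test_interior (h : R) (f : R * R -> R) : Prop :=
  smooth_cyl f /\
  exists2 d : R, 0 < d & forall x y : R, y <= d \/ h - d <= y -> f (x, y) = 0.

(* Du a b is the distributional derivative of u_a with respect to x^b. *)
Definition weak_gradient (h : R) (u : vfield) (Du : 'I_2 -> vfield) : Prop :=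
  forall (a b : 'I_2) (f : R * R -> R), test_interior h f ->
    cyl_integral h (fun x => u a x * partial b f x) =
    - cyl_integral h (fun x => Du a b x * f x).

Definition sobolev_H1 (h : R) (u : vfield) (Du : 'I_2 -> vfield) : Prop :=
  [/\ forall a, square_integrable h (u a),
      forall a b, square_integrable h (Du a b) &
      weak_gradient h u Du].

Definition laplacian (f : R * R -> R) : R * R -> R :=
  fun x => \sum_(b < 2) partial b (partial b f) x.

Definition divergence (v : vfield) : R * R -> R :=
  fun x => \sum_(b < 2) partial b (v b) x.

Definition elasticity (lam mu : R) (v : vfield) : vfield := fun a x =>
  - mu * laplacian (v a) x - (lam + mu) * partial a (divergence v) x.

(* L u = f in the sense of distributions (L is formally self-adjoint). *)
Definition weak_elasticity (h lam mu : R) (u f : vfield) : Prop :=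
  forall v : vfield, (forall a, test_interior h (v a)) ->
    cyl_integral h (fun x => \sum_(a < 2) u a x * elasticity lam mu v a x) =
    cyl_integral h (fun x => \sum_(a < 2) f a x * v a x).

Definition boundary (h : R) : set (R * R) := [set x | x.2 = 0 \/ x.2 = h].

(* Exterior unit normal; only meaningful on [boundary h]. *)
Definition normal (x : R * R) : 'I_2 -> R :=
  fun a => if a == 0 then 0 else if x.2 == 0 then -1 else 1.

(* The pairing of n . u with f in L^2(boundary), written by the divergence
   theorem as int_M (f div u + u . grad f); this is the normal trace of u. *)
Definition normal_trace (h : R) (u : vfield) (Du : 'I_2 -> vfield)
    (f : R * R -> R) : R :=
  cyl_integral h (fun x =>
    (\sum_(a < 2) Du a a x) * f x + \sum_(a < 2) u a x * partial a f x).

(* (T u)_a at a point with normal n, where D a b stands for d_b u_a. *)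
Definition traction (lam mu : R) (n : 'I_2 -> R) (D : 'I_2 -> 'I_2 -> R)
    (a : 'I_2) : R :=
  lam * n a * (\sum_(b < 2) D b b) +
  mu * (\sum_(b < 2) n b * D a b + \sum_(b < 2) n b * D b a).

(* The traction is linear in n, so (T u)_a = \sum_b (stress u)_ab n_b. *)
Definition stress (lam mu : R) (D : 'I_2 -> 'I_2 -> R) (a b : 'I_2) : R :=
  traction lam mu (fun c => (c == b)%:R) D a.

(* The pairing of T u with v in L^2(boundary), for u in H^1 with L u = f in
   L^2. Since L u = - div (stress u), the divergence theorem writes it as
   int_M (stress u : grad v - f . v). *)
Definition traction_trace (h lam mu : R) (Du : 'I_2 -> vfield) (f v : vfield) : R :=
  cyl_integral h (fun x =>
    (\sum_(a < 2) \sum_(b < 2)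
      stress lam mu (fun c d => Du c d x) a b * partial b (v a) x)
    - \sum_(a < 2) f a x * v a x).

Definition tangential (h : R) (v : vfield) : Prop :=
  forall x, boundary h x -> \sum_(a < 2) normal x a * v a x = 0.

(* The pairing of T u - (n . T u) n with v is that of T u with the tangential
   part v - (n . v) n, so it vanishes for all v exactly when T u annihilates
   the tangential v. *)
Definition FD_solution (h lam mu Lambda : R) (u : vfield) : Prop :=
  exists Du : 'I_2 -> vfield,
  [/\ sobolev_H1 h u Du,
      weak_elasticity h lam mu u (fun a x => Lambda * u a x),
      forall v : vfield, (forall a, smooth_cyl (v a)) -> tangential h v ->
        traction_trace h lam mu Du (fun a x => Lambda * u a x) v = 0 &
      forall f, smooth_cyl f -> normal_trace h u Du f = 0].

Definition FD_eigenvalue (h lam mu Lambda : R) : Prop :=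
  exists2 u : vfield, FD_solution h lam mu Lambda u &
    ~ ae_eq_vfield h u (fun _ _ => 0).

(* m is the dimension of the space of solutions, where solutions equal almost
   everywhere are identified; m = 0 when Lambda is not an eigenvalue. *)
Definition FD_multiplicity (h lam mu Lambda : R) (m : nat) : Prop :=
  exists e : 'I_m -> vfield,
  [/\ forall i, FD_solution h lam mu Lambda (e i),
      forall c : 'I_m -> R,
        ae_eq_vfield h (fun a x => \sum_(i < m) c i * e i a x) (fun _ _ => 0) ->
        forall i, c i = 0 &
      forall u, FD_solution h lam mu Lambda u ->
        exists c : 'I_m -> R,
          ae_eq_vfield h u (fun a x => \sum_(i < m) c i * e i a x)].

(* The number of occurrences of Lambda in a series of values indexed by
   positive integers. *)
Definition occurs1 (s : nat -> R) (Lambda : R) (m : nat) : Prop :=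
  [set k : nat | (0 < k)%N /\ s k = Lambda] #= `I_m.

Definition occurs2 (s : nat -> nat -> R) (Lambda : R) (m : nat) : Prop :=
  [set p : nat * nat | [/\ (0 < p.1)%N, (0 < p.2)%N & s p.1 p.2 = Lambda]] #= `I_m.

End Defs.

(* Main.v *)
Require Import Defs.
From mathcomp Require Import all_boot all_order all_algebra.
From mathcomp Require Import all_classical all_reals all_analysis.
From mathcomp Require Import measurable_realfun ring lra.
Import Order.TTheory GRing.Theory Num.Theory.
Import numFieldNormedType.Exports.
Local Open Scope classical_set_scope.
Local Open Scope ring_scope.

(** The eigenvalue problem is solved by separation of variables.  Put
    ka = k pi / h, and call wave a product of sin or cos of n x1 with sin or
    cos of ka x2.  For each n, k and each parity s in x1, the fields
    (A U, B W), where U is a wave with a cosine in x2 and W the wave of the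
    opposite parity in x1 with a sine in x2, form a plane that the elasticity
    operator preserves.  All its members satisfy the boundary conditions: the
    normal component contains the sine in x2, and so does the tangential
    traction mu (d_2 u_1 + d_1 u_2).  With xi = (+- n, ka), the operator acts on
    (A, B) as the symmetric matrix mu |xi|^2 + (lam + mu) xi xi^T.  Its
    eigenvectors are xi, which gives a gradient field with eigenvalue
    (lam + 2 mu) |xi|^2, and the vector orthogonal to xi, which gives a
    divergence-free field with eigenvalue mu |xi|^2.  The nonzero fields obtained
    in this way are the modes; listing the parities for which a mode is nonzero,
    according to whether n or k is 0, gives the five series, together with the
    translation (1, 0), whose eigenvalue is 0.

    There are no other eigenfunctions.  If u is a weak solution with eigenvalue
    L and V is a mode with eigenvalue L', integration by parts gives
    (L' - L) <u, V> = 0 ([solution_dot_field]).  The weak gradient of u may be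
    integrated by parts only against functions that vanish near the boundary,
    while V does not vanish there.  Smooth cutoffs close this gap
    ([sobolev_ibp]): wherever a derivative in x2 falls on a cutoff, the wave has
    a sine in x2, and the product of this sine with the derivative of the cutoff
    stays bounded.  The one remaining term, d_2 u_2 against a cosine in x2, is
    given by the condition that the normal trace of u is zero
    ([sobolev_normal_ibp]).

    So u is orthogonal to all the modes of other eigenvalues, and those with
    eigenvalue L are finitely many.  The modes are mutually orthogonal
    ([mode_orthogonal]), and a field orthogonal to all of them is zero almost
    everywhere ([modes_complete]); hence u equals its projection on the span of
    the modes of eigenvalue L, and the multiplicity of L is the number of such
    modes ([multiplicity_of_modes]).

    Completeness is reduced to measure theory.  The waves with a cosine in x2
    span an algebra.  The polynomials [threshold N] converge boundedly on [0, 1]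
    to the indicator of t < 1/2; composed with suitable elements of the algebra
    they converge to the indicators of half-planes.  A function orthogonal to the
    algebra therefore has integral zero over every quadrant, hence over every
    measurable set, since the quadrants generate the Borel sets and are stable
    under intersection ([null_measurable]). *)

(** * Partial derivatives on slices *)

Section Slices.
Context {R : realType}.
Implicit Types (f g : R * R -> R) (a b : R -> R).

Let quotient0 f (x y t : R) :
  (f \o shift (x, y)) (t *: basis_vec 0) = ((fun s => f (s, y)) \o shift x) (t *: 1).
Proof.
rewrite /shift /= (_ : _ + _ = (t *: 1 + x, t *: 0 + y)) // scaler0 add0r //.
Qed.

Let quotient1 f (x y t : R) :
  (f \o shift (x, y)) (t *: basis_vec 1) = ((fun s => f (x, s)) \o shift y) (t *: 1).
Proof.
rewrite /shift /= (_ : _ + _ = (t *: 0 + x, t *: 1 + y)) // scaler0 add0r //.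
Qed.

Lemma partial0E f (x y : R) : partial 0 f (x, y) = 'D_1 (fun s => f (s, y)) x.
Proof. by rewrite /partial /derive; under eq_fun do rewrite quotient0. Qed.

Lemma partial1E f (x y : R) : partial 1 f (x, y) = 'D_1 (fun t => f (x, t)) y.
Proof. by rewrite /partial /derive; under eq_fun do rewrite quotient1. Qed.

Lemma derivable0E f (x y : R) :
  derivable f (x, y) (basis_vec 0) = derivable (fun s => f (s, y)) x 1.
Proof. by rewrite /derivable; under eq_fun do rewrite quotient0. Qed.

Lemma derivable1E f (x y : R) :
  derivable f (x, y) (basis_vec 1) = derivable (fun t => f (x, t)) y 1.
Proof. by rewrite /derivable; under eq_fun do rewrite quotient1. Qed.

End Slices.

(** * Smooth functions of one variable and cutoffs *)

Section Smooth1.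
Context {R : realType}.
Implicit Types (a b : R -> R).

(** Differentiability to a finite order makes closure under products an
    induction on the order, with no formula for higher derivatives. *)
Fixpoint diff_upto (n : nat) (a : R -> R) : Prop :=
  if n is m.+1 then (forall x, derivable a x 1) /\ diff_upto m (derive1 a) else True.

Definition smooth1 a := forall n, diff_upto n a.

Lemma smooth1_derivable {a} x : smooth1 a -> derivable a x 1.
Proof. by move=> /(_ 1%N) []. Qed.

Lemma smooth1_deriv a : smooth1 a -> smooth1 (derive1 a).
Proof. by move=> sa n; have [] := sa n.+1. Qed.

Lemma derive1_is a b : (forall t : R, is_derive t 1 a (b t)) -> derive1 a = b.
Proof. by move=> ab; apply/funext => t; rewrite derive1E; have [] := ab t. Qed.

Lemma derivable_continuous1 a : (forall x, derivable a x 1) -> continuous a.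
Proof.
by move=> da x; apply: differentiable_continuous; apply/derivable1_diffP.
Qed.

Lemma smooth1_continuous a : smooth1 a -> continuous a.
Proof.
by move=> sa; apply: derivable_continuous1 => x; exact: smooth1_derivable.
Qed.

Lemma diff_upto_le n a : diff_upto n.+1 a -> diff_upto n a.
Proof. by elim: n a => [//|n IH] a [da sa]; split => //; exact: IH. Qed.

Lemma diff_uptoD n a b : diff_upto n a -> diff_upto n b ->
  diff_upto n (fun x => a x + b x).
Proof.
elim: n a b => [//|n IH] a b [da sa] [db sb]; split; first by move=> x; exact: derivableD.
rewrite (_ : derive1 _ = fun x => derive1 a x + derive1 b x); first exact: IH.
by apply/funext => x; rewrite !derive1E deriveD.
Qed.

Lemma diff_uptoM n a b : diff_upto n a -> diff_upto n b ->
  diff_upto n (fun x => a x * b x).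
Proof.
elim: n a b => [//|n IH] a b sa sb; have [da sa'] := sa; have [db sb'] := sb.
split; first by move=> x; exact: derivableM.
rewrite (_ : derive1 _ = fun x => a x * derive1 b x + b x * derive1 a x).
  by apply: diff_uptoD; apply: IH => //; exact: diff_upto_le.
by apply/funext => x; rewrite !derive1E (@deriveM _ _ a b).
Qed.

Lemma diff_upto_cst n (c : R) : diff_upto n (fun=> c).
Proof.
elim: n c => [//|n IH] c; split; first by move=> x; exact: derivable_cst.
by rewrite (_ : derive1 _ = fun=> 0)//; apply/funext => x; rewrite derive1_cst.
Qed.

Lemma diff_uptoZ n (c : R) a : diff_upto n a -> diff_upto n (fun x => c * a x).
Proof. by move=> sa; apply: diff_uptoM => //; exact: diff_upto_cst. Qed.

Lemma is_derive_affine (p q x : R) : is_derive x 1 (fun t : R => p * t + q) p.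
Proof.
rewrite (_ : (fun t => _) = (p \*: (id : R -> R)) + cst q) //.
by apply: is_derive_eq; rewrite addr0 /GRing.scale/= mulr1.
Qed.

Lemma diff_upto_affine n (p q : R) a : diff_upto n a ->
  diff_upto n (fun x => a (p * x + q)).
Proof.
elim: n a => [//|n IH] a [da sa].
have dc (x : R) : is_derive x 1 (fun x => a (p * x + q)) (derive1 a (p * x + q) * p).
  apply: (@is_derive1_comp _ a (fun x => p * x + q)); last exact: is_derive_affine.
  by rewrite derive1E; apply: DeriveDef.
split; first by move=> x; have [] := dc x.
rewrite (_ : derive1 _ = fun x => p * derive1 a (p * x + q)).
  by apply: diff_uptoZ; exact: IH.
by apply: derive1_is => x; rewrite mulrC; exact: dc.
Qed.

Definition sg (s : bool) : R := if s then 1 else -1.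

Lemma sgN (s : bool) : sg (~~ s) = - sg s :> R.
Proof. by case: s; rewrite /sg //= opprK. Qed.

Lemma sg_neq0 (s : bool) : sg s != 0 :> R.
Proof. by case: s; rewrite /sg //= ?oppr_eq0 oner_neq0. Qed.

Lemma sg_sqr (s : bool) : sg s * sg s = 1 :> R.
Proof. by case: s; rewrite /sg //= ?mulr1 ?mulrNN ?mulr1. Qed.

Definition trig (s : bool) (w t : R) : R := if s then sin (w * t) else cos (w * t).

Lemma is_derive_trig s (w t : R) :
  is_derive t 1 (trig s w) (sg s * w * trig (~~ s) w t).
Proof.
have sc : is_derive t 1 (fun t => w * t) w.
  have := is_derive_affine w 0 t.
  by rewrite (_ : (fun t => _) = ( *%R w)) // ; apply/funext => r; rewrite addr0.
rewrite /trig /sg; case: s => /=.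
  apply: (is_derive_eq (@is_derive1_comp _ (@sin R) (fun t => w * t) _ _ _ _ sc)).
  by rewrite mul1r mulrC.
apply: (is_derive_eq (@is_derive1_comp _ (@cos R) (fun t => w * t) _ _ _ _ sc)).
by rewrite mulN1r !mulNr mulrC.
Qed.

Lemma derive1_trig s (w : R) :
  derive1 (trig s w) = fun t => sg s * w * trig (~~ s) w t.
Proof.
exact/derive1_is/is_derive_trig.
Qed.

Lemma smooth1_trig s (w : R) : smooth1 (trig s w).
Proof.
move=> n; elim: n s => [//|n IH] s; split.
  by move=> t; have [] := is_derive_trig s w t.
by rewrite derive1_trig; exact: diff_uptoZ.
Qed.

(** The functions t^(-n) e^(-1/t) extended by 0 to t <= 0: the family is closed
    under differentiation up to linear combinations, which is what makes its
    members smooth at 0. *)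
Definition psi (n : nat) (t : R) : R := if 0 < t then t^-1 ^+ n * expR (- t^-1) else 0.

Lemma expR_ge_pow m (s : R) : 0 <= s -> s ^+ m.+1 <= m.+1%:R ^+ m.+1 * expR s.
Proof.
move=> s0; have -> : expR s = expR (s / m.+1%:R) ^+ m.+1.
  by rewrite -expRM_natl mulrC divfK.
rewrite -exprMn lerXn2r ?nnegrE ?mulr_ge0 ?expR_ge0 //.
rewrite -ler_pdivrMl // mulrC (le_trans _ (expR_ge1Dx _)) //.
by rewrite lerDr.
Qed.

(** The quadratic bound makes the difference quotient of [psi n] at 0 tend
    to 0. *)
Lemma psi_bound n (t : R) : 0 <= psi n t <= n.+2%:R ^+ n.+2 * t ^+ 2.
Proof.
rewrite /psi; case: ifPn => [t0|_]; last by rewrite lexx mulr_ge0 ?sqr_ge0.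
have ti0 : 0 <= t^-1 by rewrite invr_ge0 ltW.
rewrite mulr_ge0 ?exprn_ge0 ?expR_ge0 //=.
have := expR_ge_pow n.+1 _ ti0.
rewrite expRN ler_pdivrMr ?expR_gt0 // => /(ler_wpM2r (sqr_ge0 t)).
have -> : t^-1 ^+ n.+2 * t ^+ 2 = t^-1 ^+ n.
  by rewrite -addn2 exprD -mulrA -exprMn mulVf ?gt_eqF // expr1n mulr1.
by rewrite mulrAC.
Qed.

Lemma is_derive_psi n (t : R) :
  is_derive t 1 (psi n) (psi n.+2 t - n%:R * psi n.+1 t).
Proof.
have [t0|t0|t0] := ltgtP 0 t; last subst t.
- pose g := fun t : R => t^-1 ^+ n * expR (- t^-1).
  apply: (@near_eq_is_derive _ _ _ g).
    near=> u; rewrite /psi /g ifT //; near: u; exact: lt_nbhsr.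
  have dV : is_derive t 1 (fun u : R => u^-1) (- t ^- 2).
    apply: is_derive_eq; first by apply: (@is_deriveV _ id); rewrite gt_eqF.
    by rewrite /GRing.scale /= mulr1.
  have dg := is_deriveM (@is_deriveX _ _ _ n _ _ _ dV)
    (@is_derive1_comp _ expR _ _ _ _ (is_derive_expR _) (is_deriveN dV)).
  rewrite (_ : g = (fun u => u^-1) ^+ n * (expR \o - (fun u => u^-1))); last first.
    by apply/funext => u; rewrite /g /= exprfctE.
  apply: (is_derive_eq dg); rewrite exprfctE.
  rewrite /psi t0 /GRing.scale /=.
  case: n {g dg} => [|n] /=; rewrite ?mul0r ?expr0 ?exprS; field; exact: lt0r_neq0.
- apply: (@near_eq_is_derive _ _ _ (cst 0)).
    near=> u; rewrite /psi ltNge ltW //; near: u; exact: lt_nbhsl.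
  by rewrite /psi ltNge (ltW t0) /= mulr0 subr0; exact: is_derive_cst.
- rewrite /psi ltxx mulr0 subr0.
  suff H : (fun h : R => h^-1 *: ((psi n \o shift 0) (h *: 1) - psi n 0)) @ 0^' --> (0 : R).
    apply: DeriveDef; last by rewrite /derive; apply/cvg_lim.
    by apply/cvg_ex; exists 0.
  have psi0 : psi n 0 = 0 by rewrite /psi ltxx.
  apply/cvgr0Pnorm_lt => e e0.
  have C0 : 0 < n.+2%:R ^+ n.+2 :> R by rewrite exprn_gt0.
  near=> u; rewrite psi0 subr0 /= addr0 /GRing.scale /= mulr1 normrM.
  have u0 : u != 0 by near: u; exact: nbhs_dnbhs_neq.
  have /andP[p0 pC] := psi_bound n u.
  rewrite (ger0_norm p0) normfV mulrC ltr_pdivrMr ?normr_gt0 //.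
  apply: (le_lt_trans pC); rewrite -real_normK ?num_real // expr2 mulrA.
  rewrite ltr_pM2r ?normr_gt0 // mulrC -ltr_pdivlMr //.
  near: u; apply: dnbhs0_lt; exact: divr_gt0.
Unshelve. all: by end_near.
Qed.

Lemma diff_upto_psi m n : diff_upto m (psi n).
Proof.
elim: m n => [//|m IH] n; split; first by move=> t; have [] := is_derive_psi n t.
rewrite (derive1_is _ _ (is_derive_psi n)).
rewrite (_ : (fun t => _) = fun t => psi n.+2 t + (- n%:R) * psi n.+1 t).
  by apply: diff_uptoD => //; exact: diff_uptoZ.
by apply/funext => t; rewrite mulNr.
Qed.

(** A cutoff supported in [1/(N+1), h - 1/(N+1)], tending to 1 inside ]0, h[ as
    N grows: for fixed y > 0 the argument (N+1) y - 1 tends to infinity, where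
    e^(-1/t) tends to 1. *)
Definition chi (h : R) (N : nat) (y : R) : R :=
  psi 0 (N.+1%:R * y - 1) * psi 0 (N.+1%:R * (h - y) - 1).

Definition dchi (h : R) (N : nat) (y : R) : R :=
  N.+1%:R * psi 2 (N.+1%:R * y - 1) * psi 0 (N.+1%:R * (h - y) - 1) -
  psi 0 (N.+1%:R * y - 1) * (N.+1%:R * psi 2 (N.+1%:R * (h - y) - 1)).

Let chiE h N : chi h N = fun y => psi 0 (N.+1%:R * y - 1) *
  psi 0 ((- N.+1%:R) * y + (N.+1%:R * h - 1)).
Proof. by apply/funext => y; rewrite /chi; congr (_ * psi 0 _); ring. Qed.

Lemma smooth1_chi h N : smooth1 (chi h N).
Proof.
by move=> n; rewrite chiE; apply: diff_uptoM;
  apply: diff_upto_affine; exact: diff_upto_psi.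
Qed.

Lemma is_derive_chi h N (y : R) : is_derive y 1 (chi h N) (dchi h N y).
Proof.
have d0 (t : R) : is_derive t 1 (psi 0) (psi 2 t).
  by apply: (is_derive_eq (is_derive_psi 0 t)); rewrite mul0r subr0.
have da (p q z : R) : is_derive z 1 (fun y => psi 0 (p * y + q)) (psi 2 (p * z + q) * p).
  exact: (@is_derive1_comp _ (psi 0) (fun y => p * y + q) _ _ _ (d0 _) (is_derive_affine _ _ _)).
rewrite chiE; apply: (is_derive_eq (is_deriveM (da _ _ _) (da _ _ _))).
rewrite /GRing.scale /= /dchi.
have -> : - N.+1%:R * y + (N.+1%:R * h - 1) = N.+1%:R * (h - y) - 1 by ring.
by ring.
Qed.

Lemma psi_le0 n (t : R) : t <= 0 -> psi n t = 0.
Proof. by rewrite /psi ltNge => ->. Qed.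

Lemma psi_ge0 n (t : R) : 0 <= psi n t.
Proof. by have /andP[] := psi_bound n t. Qed.

Lemma psi0_le1 (t : R) : psi 0 t <= 1.
Proof.
rewrite /psi; case: ifPn => // t0; rewrite expr0 mul1r -expR0 ler_expR.
by rewrite oppr_le0 invr_ge0 ltW.
Qed.

Lemma psi0_near1 (t : R) : 0 < t -> `|1 - psi 0 t| <= t^-1.
Proof.
move=> t0; rewrite ger0_norm ?subr_ge0 ?psi0_le1 // /psi t0 expr0 mul1r.
by have := expR_ge1Dx (- t^-1); lra.
Qed.

(** As (N+1) y is t + 1 for t = (N+1) y - 1, this bounds y times the derivative of
    the cutoff, and shows that the derivative tends to 0 at each fixed y > 0. *)
Lemma psi2_near0 (t : R) : 0 < t -> (t + 1) * psi 2 t <= t^-1.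
Proof.
move=> t0; rewrite /psi t0.
have ti0 : 0 < t^-1 by rewrite invr_gt0.
have -> : (t + 1) * (t^-1 ^+ 2 * expR (- t^-1)) = t^-1 * ((1 + t^-1) * expR (- t^-1)).
  by field; rewrite gt_eqF.
rewrite ler_piMr ?(ltW ti0) // expRN ler_pdivrMr ?expR_gt0 // mul1r.
exact: expR_ge1Dx.
Qed.

Lemma psi2_bound (t : R) : -1 <= t -> 0 <= (t + 1) * psi 2 t <= 5.
Proof.
move=> t1; have t2 : 0 <= t + 1 by lra.
rewrite mulr_ge0 ?psi_ge0 //=.
have [t0|t0] := leP t 0; first by rewrite psi_le0 // mulr0.
rewrite /psi t0 expRN; set s := t^-1.
have -> : (t + 1) * (s ^+ 2 / expR s) = (s + s ^+ 2) / expR s.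
  by rewrite /s; field; rewrite ?gt_eqF ?expR_gt0.
have s0 : 0 <= s by rewrite invr_ge0 ltW.
rewrite ler_pdivrMr ?expR_gt0 //.
by have := expR_ge_pow 0 _ s0; have := expR_ge_pow 1 _ s0; lra.
Qed.

Let near_ge (y M : R) : 0 < y -> \forall n \near \oo, M <= n.+1%:R * y - 1.
Proof.
move=> y0; near=> n; rewrite lerBrDr -ler_pdivrMr //.
rewrite (le_trans (_ : _ <= n%:R)) ?ler_nat //.
by near: n; exact: nbhs_infty_ger.
Unshelve. all: by end_near.
Qed.

Let cvg_psi0 (y : R) : 0 < y -> psi 0 (n.+1%:R * y - 1) @[n --> \oo] --> (1 : R).
Proof.
move=> y0; apply/cvgrPdist_le => e e0; near=> n.
have M : e^-1 <= n.+1%:R * y - 1 by near: n; exact: near_ge.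
have t0 : 0 < n.+1%:R * y - 1 by apply: lt_le_trans M; rewrite invr_gt0.
apply: (le_trans (psi0_near1 _ t0)).
by rewrite -[leRHS]invrK lef_pV2 ?posrE ?invr_gt0.
Unshelve. all: by end_near.
Qed.

Let cvg_psi2 (y : R) : 0 < y -> n.+1%:R * psi 2 (n.+1%:R * y - 1) @[n --> \oo] --> (0 : R).
Proof.
move=> y0; apply/cvgr0Pnorm_le => e e0; near=> n.
have M : (e * y)^-1 <= n.+1%:R * y - 1 by near: n; exact: near_ge.
have t0 : 0 < n.+1%:R * y - 1 by apply: lt_le_trans M; rewrite invr_gt0 mulr_gt0.
rewrite ger0_norm ?mulr_ge0 ?psi_ge0 //.
rewrite -(ler_pM2r y0) mulrAC.
have := psi2_near0 _ t0; rewrite subrK => H; apply: (le_trans H).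
by rewrite -[leRHS]invrK lef_pV2 ?posrE ?invr_gt0 ?mulr_gt0.
Unshelve. all: by end_near.
Qed.

Lemma cvg_chi (h y : R) : 0 < y < h -> chi h n y @[n --> \oo] --> (1 : R).
Proof.
move=> /andP[y0 yh]; rewrite -[1]mulr1; apply: cvgM; first exact: cvg_psi0.
by apply: cvg_psi0; rewrite subr_gt0.
Qed.

Lemma cvg_dchi (h y : R) : 0 < y < h -> dchi h n y @[n --> \oo] --> (0 : R).
Proof.
move=> /andP[y0 yh]; have hy0 : 0 < h - y by rewrite subr_gt0.
rewrite (_ : 0 = 0 * 1 - 1 * 0 :> R); last by ring.
by apply: cvgB; apply: cvgM;
  [exact: cvg_psi2|exact: cvg_psi0|exact: cvg_psi0|exact: cvg_psi2].
Qed.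

Lemma chi_01 (h : R) n (y : R) : 0 <= chi h n y <= 1.
Proof.
by rewrite mulr_ge0 ?psi_ge0 //= -[leRHS]mulr1 ler_pM ?psi_ge0 ?psi0_le1.
Qed.

Lemma chi_eq0 (h : R) n (y : R) :
  y <= n.+1%:R^-1 \/ h - n.+1%:R^-1 <= y -> chi h n y = 0.
Proof.
have n0 : 0 < n.+1%:R :> R by rewrite ltr0n.
case=> H; rewrite /chi.
  rewrite [X in X * _]psi_le0 ?mul0r // subr_le0.
  by rewrite mulrC -ler_pdivlMr // div1r.
rewrite [X in _ * X]psi_le0 ?mulr0 // subr_le0.
by rewrite mulrC -ler_pdivlMr // div1r lerBlDr -lerBlDl.
Qed.

(** The derivative of the cutoff is unbounded, of size N near the boundary, but
    concentrated at distance about 1/N from it.  A factor that vanishes linearly on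
    the boundary compensates, uniformly in N; this allows dominated convergence when
    a sine in x2 is multiplied by the derivative of the cutoff. *)
Lemma dchi_bound (h K w y : R) n : 0 <= y <= h -> 0 <= K ->
  `|w| <= K * y -> `|w| <= K * (h - y) -> `|w * dchi h n y| <= 10 * K.
Proof.
move=> /andP[y0 yh] K0 wy why.
have n0 : 0 <= n.+1%:R :> R by rewrite ler0n.
have key (z : R) : 0 <= z -> `|w| <= K * z -> `|w| * (n.+1%:R * psi 2 (n.+1%:R * z - 1)) <= 5 * K.
  move=> z0 wz.
  have /andP[_] : 0 <= (n.+1%:R * z - 1 + 1) * psi 2 (n.+1%:R * z - 1) <= 5.
    by apply: psi2_bound; rewrite lerBrDr addNr mulr_ge0.
  rewrite subrK => H.
  apply: (@le_trans _ _ (K * z * (n.+1%:R * psi 2 (n.+1%:R * z - 1)))).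
    by rewrite ler_wpM2r // mulr_ge0 ?psi_ge0.
  rewrite [leRHS]mulrC (_ : _ * _ = K * (n.+1%:R * z * psi 2 (n.+1%:R * z - 1))) ?ler_wpM2l //.
  by ring.
have k1 := key _ y0 wy.
have k2 : `|w| * (n.+1%:R * psi 2 (n.+1%:R * (h - y) - 1)) <= 5 * K.
  by apply: key; rewrite ?subr_ge0.
rewrite normrM /dchi; set p := _ * psi 2 _ in k1 *; set q := _ * psi 2 _ in k2 *.
have p0 : 0 <= p by rewrite mulr_ge0 ?psi_ge0.
have q0 : 0 <= q by rewrite mulr_ge0 ?psi_ge0.
clearbody p q; set a := psi 0 _; set b := psi 0 _.
have H : `|p * a - b * q| <= p + q.
  apply: (le_trans (ler_normB _ _)); rewrite !normrM (ger0_norm p0) (ger0_norm q0).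
  rewrite !ger0_norm ?psi_ge0 // lerD //.
    by rewrite -[leRHS]mulr1 ler_wpM2l // psi0_le1.
  by rewrite -[leRHS]mul1r ler_wpM2r // psi0_le1.
apply: (le_trans (ler_wpM2l (normr_ge0 w) H)).
by rewrite mulrDr; lra.
Qed.

End Smooth1.

(** * Products of functions of one variable *)

Section Tensor.
Context {R : realType}.
Implicit Types (a b : R -> R).

Definition tensor a b : R * R -> R := fun p => a p.1 * b p.2.

Lemma partial0_tensor a b : (forall x : R, derivable a x 1) ->
  partial 0 (tensor a b) = tensor (derive1 a) b.
Proof.
move=> da; apply/funext => -[x y]; rewrite partial0E /tensor /=.
rewrite (_ : (fun s => _) = b y \*: a); last first.
  by apply/funext => s; rewrite /GRing.scale /= mulrC.
by rewrite deriveZ // derive1E mulrC.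
Qed.

Lemma partial1_tensor a b : (forall x : R, derivable b x 1) ->
  partial 1 (tensor a b) = tensor a (derive1 b).
Proof.
move=> db; apply/funext => -[x y]; rewrite partial1E /tensor /=.
by rewrite (_ : (fun s => _) = a x \*: b) // deriveZ // derive1E.
Qed.

(** Products of functions of one variable are stable under both partial
    derivatives, so the iterated derivatives never leave this class. *)
Lemma tensor_smooth a b : smooth1 a -> smooth1 b -> smooth (tensor a b).
Proof.
move=> sa sb s.
have [a' [b' [sa' sb' ->]]] : exists a' b', [/\ smooth1 a', smooth1 b' &
    foldr partial (tensor a b) s = tensor a' b'].
  elim: s => [|i s [a' [b' [sa' sb' /= ->]]]]; first by exists a, b.
  have da' x := smooth1_derivable x sa'; have db' x := smooth1_derivable x sb'.
  case: (boolP (i == 0)) => [/eqP ->|i1].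
    rewrite partial0_tensor //; exists (derive1 a'), b'; split => //.
    exact: smooth1_deriv.
  rewrite (_ : i = 1); last by apply/val_inj; case: i i1 => -[|[]].
  rewrite partial1_tensor //; exists a', (derive1 b'); split => //.
  exact: smooth1_deriv.
split.
  move=> p; apply: cvgM.
    by apply: (continuous_comp cvg_fst); exact: smooth1_continuous.
  by apply: (continuous_comp cvg_snd); exact: smooth1_continuous.
move=> i [x y]; case: (boolP (i == 0)) => [/eqP ->|i1].
  rewrite derivable0E /tensor /= (_ : (fun s => _) = b' y \*: a').
    exact/derivableZ/smooth1_derivable.
  by apply/funext => t; rewrite /GRing.scale /= mulrC.
rewrite (_ : i = 1); last by apply/val_inj; case: i i1 => -[|[]].
rewrite derivable1E /tensor /= (_ : (fun s => _) = a' x \*: b') //.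
exact/derivableZ/smooth1_derivable.
Qed.

End Tensor.

(** * Integration over the cylinder *)

Section Integration.
Context {R : realType}.
Implicit Types (f g : R * R -> R).
Notation TT := (measurableTypeR R * measurableTypeR R)%type.

(** The measurable structure on the plane is the product of two Borel structures;
    an open set belongs to it as the union of the countably many rational boxes
    that it contains. *)
Lemma continuous_measurable2 f : continuous f -> measurable_fun setT (f : TT -> R).
Proof.
move=> cf; apply: (measurability _ (RGenOInfty.measurableE R)) => _ [_ [a ->] <-].
rewrite setTI; pose U : set (R * R) := f @^-1` `]a, +oo[.
have oU : open U by apply: open_comp => [p _|]; [exact: cf|exact: interval_open].
rewrite -[X in measurable X]/(U : set TT).
pose box (q : (rat * rat) * (rat * rat)) : set TT :=
  `]ratr q.1.1, ratr q.1.2[ `*` `]ratr q.2.1, ratr q.2.2[.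
pose boxU q := [set p | box q p /\ box q `<=` U].
have -> : (U : set TT) = \bigcup_q boxU q.
  apply/seteqP; split => [[x y] Uxy|p [q _]]; last first.
    by case=> qp; exact.
  have /nbhs_ballP[e /= e0 eU] : nbhs ((x, y) : R * R) U by exact: open_nbhs_nbhs.
  have [q1] := @rat_in_itvoo R (x - e) x ltac:(lra).
  have [q2] := @rat_in_itvoo R x (x + e) ltac:(lra).
  have [r1] := @rat_in_itvoo R (y - e) y ltac:(lra).
  have [r2] := @rat_in_itvoo R y (y + e) ltac:(lra).
  rewrite !in_itv /= => /andP[a1 a2] /andP[b1 b2] /andP[c1 c2] /andP[d1 d2].
  exists ((q1, q2), (r1, r2)) => //; split.
    by split; rewrite /= in_itv /=; apply/andP.
  move=> [z w] [/= + +]; rewrite !in_itv /= => /andP[z1 z2] /andP[w1 w2].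
  by apply: eU; split; rewrite /ball /= ltr_norml; lra.
apply: countable_bigcupT_measurable; first exact: countableP.
move=> q; have [qU|qU] := pselect (box q `<=` U).
  rewrite (_ : boxU q = box q); last by apply/seteqP; split=> p // [].
  by apply: measurableX; exact: measurable_itv.
by rewrite (_ : boxU q = set0) //; apply/seteqP; split=> p // [].
Qed.

Lemma measurable_cylinder (h : R) : measurable (cylinder h : set TT).
Proof. by apply: measurableX; exact: measurable_itv. Qed.

Lemma lebesgue2X (A B : set (measurableTypeR R)) : measurable A -> measurable B ->
  lebesgue2 (A `*` B) = (lebesgue_measure A * lebesgue_measure B)%E.
Proof. by move=> mA mB; exact: (product_measure1E _ _ mA mB). Qed.

Lemma lebesgue2_cylinder (h : R) : 0 <= h -> lebesgue2 (cylinder h) = (2 * pi * h)%:E.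
Proof.
move=> h0; rewrite /cylinder lebesgue2X; [|exact: measurable_itv..].
rewrite !lebesgue_measure_itv /= !lte_fin.
rewrite mulr_gt0 ?pi_gt0 // oppr0 adde0.
case: ltP => // hh; first by rewrite adde0 -EFinM.
by have -> : h = 0; [apply/le_anti/andP|rewrite mulr0 mule0].
Qed.

Lemma bounded_cylinder (h : R) f : continuous f ->
  exists2 M : R, 0 <= M & forall p, cylinder h p -> `|f p| <= M.
Proof.
move=> cf; pose K : set (R * R) := `[0, 2 * pi] `*` `[0, h].
have cK : compact K by apply: compact_setX; exact: segment_compact.
have := @continuous_compact _ _ f K (continuous_subspaceT cf) cK.
move=> /compact_bounded [M [Mr HM]].
exists (`|M| + 1); first by rewrite addr_ge0.
move=> [x y] [/= + +]; rewrite !in_itv /= => /andP[x0 x1] /andP[y0 y1].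
apply: (HM (`|M| + 1)); first by rewrite (le_lt_trans (ler_norm _)) // ltrDl.
by exists (x, y) => //; split; rewrite /= in_itv /= ?x0 ?y0 ?(ltW x1).
Qed.

Lemma integrable_bounded_cylinder (h M : R) f :
  0 <= h -> measurable_fun (cylinder h) (f : TT -> R) ->
  (forall p, cylinder h p -> `|f p| <= M) ->
  lebesgue2.-integrable (cylinder h) (EFin \o f).
Proof.
move=> h0 mf fM; apply: (measurable_bounded_integrable (measurable_cylinder h)).
- by rewrite lebesgue2_cylinder // ltry.
- exact: mf.
- exists M; split; first exact: num_real.
  by move=> y My p /fM Mp; apply: le_trans Mp _; exact: ltW.
Qed.

Lemma integrable_continuous (h : R) f : 0 <= h -> continuous f ->
  lebesgue2.-integrable (cylinder h) (EFin \o f).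
Proof.
move=> h0 cf; have [M _ fM] := bounded_cylinder h f cf.
apply: (integrable_bounded_cylinder h M) => //.
exact: (measurable_funTS (continuous_measurable2 _ cf)).
Qed.

Lemma continuous_slice0 f (y : R) : continuous f -> continuous (fun x => f (x, y)).
Proof.
move=> cf x; apply: (@continuous2_cvg _ _ _ _ _ _ id (cst y) (fun a b => f (a, b))).
- by rewrite (_ : (fun z => _) = f); [exact: cf|apply/funext => -[]].
- exact: cvg_id.
- exact: cvg_cst.
Qed.

Lemma continuous_slice1 f (x : R) : continuous f -> continuous (fun y => f (x, y)).
Proof.
move=> cf y; apply: (@continuous2_cvg _ _ _ _ _ _ (cst x) id (fun a b => f (a, b))).
- by rewrite (_ : (fun z => _) = f); [exact: cf|apply/funext => -[]].
- exact: cvg_cst.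
- exact: cvg_id.
Qed.

Lemma fubini_cylinder0 (h : R) f : 0 <= h -> continuous f ->
  (forall y, 0 <= y <= h ->
    (\int[lebesgue_measure]_(x in `[0%R, (2 * pi)%R]) (f (x, y))%:E = 0)%E) ->
  cyl_integral h f = 0.
Proof.
move=> h0 cf f0; rewrite /cyl_integral /Rintegral integral_mkcond.
set F := _ \_ _.
have iF : lebesgue2.-integrable setT F.
  apply/(integrable_mkcond _ (measurable_cylinder h)).1.
  exact: integrable_continuous.
have <- := @integral21_prod_meas1 _ _ _ _ R (@lebesgue_measure R) (@lebesgue_measure R) F iF.
rewrite integral0_eq // => y _; rewrite /fubini_G.
have [yh|yh] := boolP (0 <= y <= h).
  rewrite -(f0 y yh) -integral_itv_bndo_bndc; last first.
    apply/measurable_EFinP/measurable_funTS.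
    exact: (@continuous_measurable_fun R (fun x => f (x, y)) (@continuous_slice0 f y cf)).
  rewrite [RHS]integral_mkcond; apply: eq_integral => x _.
  rewrite /F /patch; congr (if _ then _ else _).
  by rewrite /cylinder in_setX [X in _ && X]mem_set ?andbT //= in_itv.
rewrite integral0_eq // => x _; rewrite /F patchE memNset //.
by case=> _ /=; rewrite in_itv /= (negbTE yh).
Qed.

Lemma fubini_cylinder1 (h : R) f : 0 <= h -> continuous f ->
  (forall x, (\int[lebesgue_measure]_(y in `[0%R, h]) (f (x, y))%:E = 0)%E) ->
  cyl_integral h f = 0.
Proof.
move=> h0 cf f0; rewrite /cyl_integral /Rintegral integral_mkcond.
set F := _ \_ _.
have iF : lebesgue2.-integrable setT F.
  apply/(integrable_mkcond _ (measurable_cylinder h)).1.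
  exact: integrable_continuous.
have <- := @integral12_prod_meas1 _ _ _ _ R (@lebesgue_measure R) (@lebesgue_measure R) F iF.
rewrite integral0_eq // => x _; rewrite /fubini_F.
have [xh|xh] := boolP (x \in `[0, 2 * pi[).
  rewrite -(f0 x) [RHS]integral_mkcond; apply: eq_integral => y _.
  rewrite /F /patch; congr (if _ then _ else _).
  by rewrite /cylinder in_setX [X in X && _]mem_set.
rewrite integral0_eq // => y _; rewrite /F patchE memNset //.
by case=> /=; rewrite (negbTE xh).
Qed.

(** The derivative of a function with equal values at the two ends has integral
    zero.  The two partial derivatives on the cylinder use it differently: around
    the circle by periodicity, across the width by the boundary values. *)
Lemma FTC_circuit (a b : R) (g g' : R -> R) : a < b -> (forall x : R, is_derive x 1 g (g' x)) ->
  continuous g' -> g a = g b -> (\int[lebesgue_measure]_(x in `[a, b]) (g' x)%:E = 0)%E.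
Proof.
move=> ab dg cg' gab.
have cg : continuous g by apply: derivable_continuous1 => x; have [] := dg x.
rewrite (@continuous_FTC2 _ g' g a b ab) ?gab ?subee //.
- exact: continuous_subspaceT.
- split.
  + by move=> x _; have [] := dg x.
  + by apply: cvg_at_right_filter; exact: cg.
  + by apply: cvg_at_left_filter; exact: cg.
- by move=> x _; rewrite (derive1_is _ _ dg).
Qed.

Lemma partial0_integral (h : R) f : 0 <= h ->
  (forall p, derivable f p (basis_vec 0)) -> continuous (partial 0 f) ->
  (forall y, f (0, y) = f (2 * pi, y)) -> cyl_integral h (partial 0 f) = 0.
Proof.
move=> h0 df cf f0; apply: fubini_cylinder0 => // y _.
have pi2 : 0 < 2 * pi :> R by rewrite mulr_gt0 // pi_gt0.
apply: (@FTC_circuit _ _ (fun x => f (x, y)) _ pi2) => //; last exact: continuous_slice0.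
by move=> x; apply: DeriveDef; [rewrite -derivable0E|rewrite partial0E].
Qed.

Lemma partial1_integral (h : R) f : 0 < h ->
  (forall p, derivable f p (basis_vec 1)) -> continuous (partial 1 f) ->
  (forall x, f (x, 0) = f (x, h)) -> cyl_integral h (partial 1 f) = 0.
Proof.
move=> h0 df cf f0; apply: fubini_cylinder1 => // [|x]; first exact: ltW.
apply: (@FTC_circuit _ _ (fun y => f (x, y)) _ h0) => //; last exact: continuous_slice1.
by move=> y; apply: DeriveDef; [rewrite -derivable1E|rewrite partial1E].
Qed.

End Integration.

(** * Waves and the fields built from them *)

Section Modes.
Context {R : realType}.
Implicit Types (f g : R * R -> R) (h : R).

Lemma ord2P (P : 'I_2 -> Prop) : P 0 -> P 1 -> forall a, P a.
Proof.
move=> P0 P1 [[|[|//]] i2].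
  by rewrite (_ : Ordinal i2 = 0); last exact/val_inj.
by rewrite (_ : Ordinal i2 = 1); last exact/val_inj.
Qed.

Lemma sum2 (F : 'I_2 -> R) : \sum_(a < 2) F a = F 0 + F 1.
Proof.
by rewrite !big_ord_recl big_ord0 addr0; congr (F _ + F _); exact/val_inj.
Qed.

(** The symmetric form of the elastic energy density: both the traction condition
    for a mode and the one for an arbitrary solution are read off from it. *)
Lemma stress_contract (lam mu : R) (D G : 'I_2 -> 'I_2 -> R) :
  \sum_(a < 2) \sum_(b < 2) stress lam mu D a b * G a b =
  lam * (D 0 0 + D 1 1) * (G 0 0 + G 1 1) +
  2 * mu * (D 0 0 * G 0 0 + D 1 1 * G 1 1) +
  mu * (D 0 1 + D 1 0) * (G 0 1 + G 1 0).
Proof. by rewrite !sum2 /stress /traction !sum2 /=; ring. Qed.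

Lemma elasticityE (lam mu : R) (v : vfield) a p :
  elasticity lam mu v a p = - mu * (partial 0 (partial 0 (v a)) p +
    partial 1 (partial 1 (v a)) p) - (lam + mu) * partial a (divergence v) p.
Proof. by rewrite /elasticity /laplacian sum2. Qed.

Definition cyl_integrable (h : R) f :=
  lebesgue2.-integrable (cylinder h) (EFin \o f).

(** Carrying integrability along with the value lets linear combinations of
    integrals be computed in one step. *)
Definition has_integral h f (v : R) := cyl_integrable h f /\ cyl_integral h f = v.

Lemma eq_cyl_integral h f g : f =1 g -> cyl_integral h f = cyl_integral h g.
Proof. by move=> fg; congr cyl_integral; apply/funext. Qed.

Lemma has_integralD {h f g} {v w : R} : has_integral h f v -> has_integral h g w ->
  has_integral h (fun p => f p + g p) (v + w).
Proof.
move=> [fi <-] [gi <-]; have mC := measurable_cylinder h.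
by split; [exact: (integrableD mC fi gi)|rewrite /cyl_integral RintegralD].
Qed.

Lemma has_integralZ {h f} {v : R} (c : R) : has_integral h f v ->
  has_integral h (fun p => c * f p) (c * v).
Proof.
move=> [fi <-]; have mC := measurable_cylinder h.
by split; [exact: (integrableZl mC c fi)|rewrite /cyl_integral RintegralZl].
Qed.

Lemma has_integral_eq {h f g} {v w : R} : has_integral h f v -> f =1 g -> v = w ->
  has_integral h g w.
Proof. by move=> + /funext fg vw; rewrite fg vw. Qed.

Lemma has_integral_val {h f} {v : R} : has_integral h f v -> cyl_integral h f = v.
Proof. by case. Qed.

Lemma has_integral_self {h f} : cyl_integrable h f -> has_integral h f (cyl_integral h f).
Proof. by []. Qed.

Definition C1 f := continuous f /\
  forall b, continuous (partial b f) /\ forall p, derivable f p (basis_vec b).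

Definition periodic f := forall x y : R, f (x + 2 * pi, y) = f (x, y).

Definition vanishes h f := forall x : R, f (x, 0) = 0 /\ f (x, h) = 0.

Lemma smooth_partial b f : smooth f -> smooth (partial b f).
Proof. by move=> sf s; have := sf (rcons s b); rewrite foldr_rcons. Qed.

Lemma smooth_C1 f : smooth f -> C1 f.
Proof.
move=> sf; split; first by have [] := sf [::].
by move=> b; split; [have [] := sf [:: b]|have [_ +] := sf [::]; apply].
Qed.

Lemma smooth_cyl_partial b f : smooth_cyl f -> smooth_cyl (partial b f).
Proof.
move=> [sf pf]; split; first exact: smooth_partial.
move=> x y; rewrite /partial /derive.
suff H (v : R * R) : f (v + (x + 2 * pi, y)) = f (v + (x, y)).
  by under eq_fun do rewrite /= /shift /= H pf.
case: v => v w; have -> : (v, w) + (x + 2 * pi, y) = (v + x + 2 * pi, w + y).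
  by congr pair; exact: addrA.
exact: pf.
Qed.

Lemma partialM b f g : C1 f -> C1 g ->
  partial b (fun p => f p * g p) = fun p => partial b f p * g p + f p * partial b g p.
Proof.
move=> [_ /(_ b)[_ df]] [_ /(_ b)[_ dg]]; apply/funext => p.
rewrite /partial [LHS](deriveM (df p) (dg p)) addrC; congr (_ + _).
exact: mulrC.
Qed.

Lemma continuousM2 f g : continuous f -> continuous g -> continuous (fun p => f p * g p).
Proof. by move=> cf cg p; apply: cvgM; [exact: cf|exact: cg]. Qed.

Lemma integrableM2 h f g : 0 < h -> continuous f -> continuous g ->
  cyl_integrable h (fun p => f p * g p).
Proof.
by move=> h0 cf cg; apply: integrable_continuous; [exact: ltW|exact: continuousM2].
Qed.

Lemma C1M f g : C1 f -> C1 g -> C1 (fun p => f p * g p).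
Proof.
move=> Cf Cg; split; first by apply: continuousM2; [case: Cf|case: Cg].
move=> b; split; last first.
  by move=> p; apply: derivableM; [case: Cf => _ /(_ b) []|case: Cg => _ /(_ b) []].
rewrite partialM // => p; apply: cvgD; apply: cvgM.
- by case: Cf => _ /(_ b) [+ _]; apply.
- by case: Cg => + _; apply.
- by case: Cf => + _; apply.
- by case: Cg => _ /(_ b) [+ _]; apply.
Qed.

Lemma integration_by_parts (h : R) b f g : 0 < h -> C1 f -> C1 g -> periodic f -> periodic g ->
  b = 0 \/ vanishes h f \/ vanishes h g ->
  cyl_integral h (fun p => f p * partial b g p) =
  - cyl_integral h (fun p => partial b f p * g p).
Proof.
move=> h0 Cf Cg pf pg bfg; have h0' := ltW h0.
have Cfg := C1M _ _ Cf Cg.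
have : cyl_integral h (partial b (fun p => f p * g p)) = 0.
  have [_ /(_ b) [cfg dfg]] := Cfg.
  case: (eqVneq b 0) cfg dfg bfg => [->|b0] cfg dfg bfg.
    by apply: partial0_integral => // y; rewrite -[2 * pi]add0r pf pg.
  have b1 : b = 1 by elim/ord2P: b b0 {cfg dfg bfg}.
  subst b; apply: partial1_integral => // x.
  by case: bfg => [//|[/(_ x) [-> ->]|/(_ x) [-> ->]]]; rewrite ?mul0r ?mulr0.
rewrite partialM // => I0.
case: Cf => cf /(_ b) [cf' _]; case: Cg => cg /(_ b) [cg' _].
have [_ +] := has_integralD (has_integral_self (integrableM2 _ _ _ h0 cf' cg))
  (has_integral_self (integrableM2 _ _ _ h0 cf cg')).
by rewrite I0 => /esym/eqP; rewrite addrC addr_eq0 => /eqP.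
Qed.

Lemma C1_smooth_cyl f : smooth_cyl f -> C1 f.
Proof. by case=> /smooth_C1. Qed.

Lemma smooth_cyl_continuous f : smooth_cyl f -> continuous f.
Proof. by move=> /C1_smooth_cyl []. Qed.

Lemma partialZ b (c : R) f : C1 f -> partial b (fun p => c * f p) = fun p => c * partial b f p.
Proof.
by move=> [_ /(_ b)[_ df]]; apply/funext => p; rewrite /partial (@deriveZ _ _ _ f).
Qed.

Lemma partialD b f g : C1 f -> C1 g ->
  partial b (fun p => f p + g p) = fun p => partial b f p + partial b g p.
Proof.
move=> [_ /(_ b)[_ df]] [_ /(_ b)[_ dg]]; apply/funext => p.
by rewrite /partial (@deriveD _ _ _ f g).
Qed.

Lemma test_interior_vanishes h f : test_interior h f -> vanishes h f.
Proof.
move=> [_ [d d0 fd]] x; split; apply: fd; [left; exact: ltW|right].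
by rewrite lerBlDr lerDl ltW.
Qed.

(** A test function is zero on a whole neighbourhood of each boundary circle, so
    its normal derivative is zero there too. *)
Lemma test_interior_partial_vanishes h b f : 0 < h -> test_interior h f -> vanishes h (partial b f).
Proof.
move=> h0 [_ [d d0 fd]] x.
have dcst (a : R -> R) (t : R) : (\near t, 0 = a t) -> 'D_(1:R) a t = 0.
  by move=> H; rewrite -(near_eq_derive _ H) derive_cst.
elim/ord2P: b.
  by rewrite !partial0E; split; apply: dcst; near=> t; rewrite fd //;
    [left; exact: ltW|right; rewrite lerBlDr lerDl ltW].
rewrite !partial1E; split; apply: dcst; near=> t; rewrite fd //.
  by left; apply: ltW; near: t; exact: lt_nbhsl.
right; apply: ltW; near: t; apply: lt_nbhsr.
by rewrite ltrBlDr ltrDl.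
Unshelve. all: by end_near.
Qed.

Definition kap (h : R) (k : nat) : R := k%:R * pi / h.

Definition wave (h : R) (s c : bool) (n k : nat) : R * R -> R :=
  tensor (trig s n%:R) (trig c (kap h k)).

Lemma wave_smooth_cyl h s c n k : smooth_cyl (wave h s c n k).
Proof.
split; first by apply: tensor_smooth; exact: smooth1_trig.
move=> x y; rewrite /wave /tensor /=; congr (_ * _).
rewrite /trig (_ : n%:R * (x + 2 * pi) = n%:R * x + pi *+ 2 *+ n); last first.
  by rewrite -[pi *+ 2]mulr_natl -mulr_natl; ring.
elim: n (n%:R * x) => [|n IH] z; first by rewrite mulr0n addr0.
by rewrite mulrSr addrA; case: s IH => IH; rewrite ?sinD2pi ?cosD2pi IH.
Qed.

Lemma partial0_wave h s c n k :
  partial 0 (wave h s c n k) = fun p => sg s * n%:R * wave h (~~ s) c n k p.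
Proof.
rewrite /wave partial0_tensor => [|x]; last exact/smooth1_derivable/smooth1_trig.
by rewrite derive1_trig; apply/funext => p; rewrite /tensor -mulrA.
Qed.

Lemma partial1_wave h s c n k :
  partial 1 (wave h s c n k) = fun p => sg c * kap h k * wave h s (~~ c) n k p.
Proof.
rewrite /wave partial1_tensor => [|x]; last exact/smooth1_derivable/smooth1_trig.
by rewrite derive1_trig; apply/funext => p; rewrite /tensor; ring.
Qed.

Lemma wave_vanishes h s n k : 0 < h -> vanishes h (wave h s true n k).
Proof.
move=> h0 x; rewrite /wave /tensor /trig /= /kap mulr0 sin0 mulr0 divfK ?gt_eqF //.
split => //; suff -> : sin (k%:R * pi) = 0 :> R by rewrite mulr0.
by rewrite mulr_natl; elim: k => [|k IH]; rewrite ?mulr0n ?sin0 // mulrSr sinDpi IH oppr0.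
Qed.

Lemma wave_continuous h s c n k : continuous (wave h s c n k).
Proof. exact/smooth_cyl_continuous/wave_smooth_cyl. Qed.

Lemma wave_ibp0 h s c n k f : 0 < h -> smooth_cyl f ->
  cyl_integral h (fun p => wave h s c n k p * partial 0 f p) =
  - (sg s * n%:R) * cyl_integral h (fun p => wave h (~~ s) c n k p * f p).
Proof.
move=> h0 sf; have sE := wave_smooth_cyl h s c n k.
rewrite integration_by_parts //; [|exact: C1_smooth_cyl..|by case: sE|by case: sf|by left].
rewrite partial0_wave mulNr; congr (- _); apply: has_integral_val.
apply: (has_integral_eq (has_integralZ _ (has_integral_self _))) => // [|p]; last exact: mulrA.
by apply: integrableM2 => //; [exact: wave_continuous|exact: smooth_cyl_continuous].
Qed.

Lemma wave_ibp1 h s c n k f : 0 < h -> smooth_cyl f -> c = true \/ vanishes h f ->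
  cyl_integral h (fun p => wave h s c n k p * partial 1 f p) =
  - (sg c * kap h k) * cyl_integral h (fun p => wave h s (~~ c) n k p * f p).
Proof.
move=> h0 sf cf; have sE := wave_smooth_cyl h s c n k.
rewrite integration_by_parts //; [|exact: C1_smooth_cyl..|by case: sE|by case: sf|]; last first.
  by right; case: cf => [->|]; [left; exact: wave_vanishes|right].
rewrite partial1_wave mulNr; congr (- _); apply: has_integral_val.
apply: (has_integral_eq (has_integralZ _ (has_integral_self _))) => // [|p]; last exact: mulrA.
by apply: integrableM2 => //; [exact: wave_continuous|exact: smooth_cyl_continuous].
Qed.

(** The parities of the two components differ in both variables: then the
    divergence, and each entry of the stress, is a multiple of a single wave. *)
Definition wave_field h s n k (A B : R) : vfield := fun a p =>
  if a == 0 then A * wave h s false n k p else B * wave h (~~ s) true n k p.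

Lemma smooth_cylZ (c : R) f : smooth_cyl f -> smooth_cyl (fun p => c * f p).
Proof.
move=> [sf pf]; split; last by move=> x y; rewrite pf.
have H : forall t, foldr partial (fun p => c * f p) t = fun p => c * foldr partial f t p.
  elim=> [//|b t /= ->]; rewrite partialZ //.
  by apply: smooth_C1; elim: t => [//|b' t]; exact: smooth_partial.
move=> t; rewrite H; have [ct dt] := sf t; split.
  by move=> p; apply: cvgM; [exact: cvg_cst|exact: ct].
by move=> b p; exact: (@derivableZ _ _ _ (foldr partial f t)).
Qed.

Lemma field_smooth_cyl h s n k A B a : smooth_cyl (wave_field h s n k A B a).
Proof.
by elim/ord2P: a; rewrite /wave_field /=; apply: smooth_cylZ; exact: wave_smooth_cyl.
Qed.

Section FieldIsSolution.
Variables (h lam mu L : R) (s : bool) (n k : nat) (A B : R).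
Hypothesis h0 : 0 < h.

Let ka := kap h k.
Let en : R := sg s * n%:R.
Let d := en * A + ka * B.
Let U := wave h s false n k.
Let W := wave h (~~ s) true n k.
Let X := wave h (~~ s) false n k.
Let Y := wave h s true n k.
Let V := wave_field h s n k A B.

(* The eigenvector equations of mu |xi|^2 + (lam + mu) xi xi^T at xi = (en, ka),
   since d is the scalar product of xi with (A, B). *)
Hypothesis eqA : mu * (n%:R ^+ 2 + ka ^+ 2) * A + (lam + mu) * en * d = L * A.
Hypothesis eqB : mu * (n%:R ^+ 2 + ka ^+ 2) * B + (lam + mu) * ka * d = L * B.

Let cE s' c : continuous (wave h s' c n k). Proof. exact: wave_continuous. Qed.

Let V0 p : V 0 p = A * U p. Proof. by []. Qed.
Let V1 p : V 1 p = B * W p. Proof. by []. Qed.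

Let en2 : en * en = n%:R ^+ 2.
Proof. by rewrite /en /sg; case: s; ring. Qed.

Let D00 p : partial 0 (V 0) p = A * en * X p.
Proof.
rewrite (_ : V 0 = fun p => A * U p) // partialZ ?partial0_wave ?mulrA //.
exact/C1_smooth_cyl/wave_smooth_cyl.
Qed.
Let D10 p : partial 1 (V 0) p = - (A * ka) * Y p.
Proof.
rewrite (_ : V 0 = fun p => A * U p) // partialZ ?partial1_wave; first by rewrite /sg /Y /ka; ring.
exact/C1_smooth_cyl/wave_smooth_cyl.
Qed.
Let D01 p : partial 0 (V 1) p = - (B * en) * Y p.
Proof.
rewrite (_ : V 1 = fun p => B * W p) // partialZ ?partial0_wave.
  by rewrite negbK sgN /Y /en; ring.
exact/C1_smooth_cyl/wave_smooth_cyl.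
Qed.
Let D11 p : partial 1 (V 1) p = B * ka * X p.
Proof.
rewrite (_ : V 1 = fun p => B * W p) // partialZ ?partial1_wave; first by rewrite /sg /X /ka /=; ring.
exact/C1_smooth_cyl/wave_smooth_cyl.
Qed.

Local Notation I f := (cyl_integral h (fun p => f p)).

Lemma weak_elasticity_field : weak_elasticity h lam mu V (fun a x => L * V a x).
Proof.
move=> v tv; have sv a : smooth_cyl (v a) by case: (tv a).
have sv' a b : smooth_cyl (partial b (v a)) by exact: smooth_cyl_partial.
have sv'' a b b' : smooth_cyl (partial b' (partial b (v a))) by exact: smooth_cyl_partial.
have vv a : vanishes h (v a) by exact: test_interior_vanishes.
have vv' a b : vanishes h (partial b (v a)) by exact: test_interior_partial_vanishes.
have divE a p : partial a (divergence v) p =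
    partial a (partial 0 (v 0)) p + partial a (partial 1 (v 1)) p.
  rewrite (_ : divergence v = fun p => partial 0 (v 0) p + partial 1 (v 1) p).
    by rewrite partialD //; exact: C1_smooth_cyl.
  by apply/funext => q; rewrite /divergence sum2.
have ibp0 s' c f : smooth_cyl f -> I (fun p => wave h s' c n k p * partial 0 f p) =
    - (sg s' * n%:R) * I (fun p => wave h (~~ s') c n k p * f p).
  by move=> sf; exact: wave_ibp0.
have ibp1 s' c f : smooth_cyl f -> vanishes h f ->
    I (fun p => wave h s' c n k p * partial 1 f p) =
    - (sg c * ka) * I (fun p => wave h s' (~~ c) n k p * f p).
  by move=> sf vf; apply: wave_ibp1 => //; right.
have sgF : sg false = -1 :> R by [].
have sgT : sg true = 1 :> R by [].
have iM s' c f : smooth_cyl f -> cyl_integrable h (fun p => wave h s' c n k p * f p).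
  by move=> sf; apply: integrableM2 => //; exact: smooth_cyl_continuous.
(* Each of the six terms of the operator applied to v is integrated by parts
   twice; no boundary term appears, as v vanishes near the boundary. *)
have T1 : I (fun p => U p * partial 0 (partial 0 (v 0)) p) = - n%:R ^+ 2 * I (fun p => U p * v 0 p).
  by rewrite (ibp0 _ _ _ (sv' 0 0)) (ibp0 _ _ _ (sv 0)) negbK sgN -en2 /en; ring.
have T2 : I (fun p => U p * partial 1 (partial 1 (v 0)) p) = - ka ^+ 2 * I (fun p => U p * v 0 p).
  by rewrite (ibp1 _ _ _ (sv' 0 1) (vv' 0 1)) (ibp1 _ _ _ (sv 0) (vv 0)) /sg /=; ring.
have T3 : I (fun p => U p * partial 0 (partial 1 (v 1)) p) = - (en * ka) * I (fun p => W p * v 1 p).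
  by rewrite (ibp0 _ _ _ (sv' 1 1)) (ibp1 _ _ _ (sv 1) (vv 1)) sgF /en /W /=; ring.
have T4 : I (fun p => W p * partial 0 (partial 0 (v 1)) p) = - n%:R ^+ 2 * I (fun p => W p * v 1 p).
  by rewrite (ibp0 _ _ _ (sv' 1 0)) (ibp0 _ _ _ (sv 1)) negbK sgN -en2 /en /W; ring.
have T5 : I (fun p => W p * partial 1 (partial 1 (v 1)) p) = - ka ^+ 2 * I (fun p => W p * v 1 p).
  by rewrite (ibp1 _ _ _ (sv' 1 1) (vv' 1 1)) (ibp1 _ _ _ (sv 1) (vv 1)) /sg /W /=; ring.
have T6 : I (fun p => W p * partial 1 (partial 0 (v 0)) p) = - (en * ka) * I (fun p => U p * v 0 p).
  by rewrite (ibp1 _ _ _ (sv' 0 0) (vv' 0 0)) (ibp0 _ _ _ (sv 0)) negbK sgN sgT /en /U /=; ring.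
have {}T1 : has_integral _ _ _ := conj (iM s false _ (sv'' 0 0 0)) T1.
have {}T2 : has_integral _ _ _ := conj (iM s false _ (sv'' 0 1 1)) T2.
have {}T3 : has_integral _ _ _ := conj (iM s false _ (sv'' 1 1 0)) T3.
have {}T4 : has_integral _ _ _ := conj (iM (~~ s) true _ (sv'' 1 0 0)) T4.
have {}T5 : has_integral _ _ _ := conj (iM (~~ s) true _ (sv'' 1 1 1)) T5.
have {}T6 : has_integral _ _ _ := conj (iM (~~ s) true _ (sv'' 0 0 1)) T6.
have S0 := has_integral_self (iM s false _ (sv 0)).
have S1 := has_integral_self (iM (~~ s) true _ (sv 1)).
transitivity (L * A * I (fun p => U p * v 0 p) + L * B * I (fun p => W p * v 1 p)); last first.
  apply/esym/has_integral_val.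
  apply: (has_integral_eq (has_integralD (has_integralZ (L * A) S0) (has_integralZ (L * B) S1))) => // p.
  by rewrite sum2 V0 V1 -!mulrA.
rewrite -eqA -eqB; apply: has_integral_val.
have H := has_integralD (has_integralZ (- (lam + 2 * mu) * A) T1)
  (has_integralD (has_integralZ (- mu * A) T2)
  (has_integralD (has_integralZ (- (lam + mu) * A) T3)
  (has_integralD (has_integralZ (- mu * B) T4)
  (has_integralD (has_integralZ (- (lam + 2 * mu) * B) T5)
                 (has_integralZ (- (lam + mu) * B) T6))))).
apply: (has_integral_eq H) => [p|].
  rewrite (sum2 (fun a => V a p * elasticity lam mu v a p)) !elasticityE !divE V0 V1.
  rewrite -/U -/W; move: (U p) (W p) (partial 0 (partial 0 (v 0)) p)
    (partial 1 (partial 1 (v 0)) p) (partial 0 (partial 1 (v 1)) p)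
    (partial 0 (partial 0 (v 1)) p) (partial 1 (partial 1 (v 1)) p)
    (partial 1 (partial 0 (v 0)) p) => u w a1 a2 a3 a4 a5 a6; ring.
move: (I (fun p => U p * v 0 p)) (I (fun p => W p * v 1 p)) => u w.
by rewrite /d -en2; ring.
Qed.

Lemma square_integrable_continuous f : continuous f -> square_integrable h f.
Proof.
move=> cf; split; first exact: (measurable_funTS (continuous_measurable2 _ cf)).
apply: integrable_continuous; first exact: ltW.
by move=> p; apply: (@continuous_comp _ _ _ f (fun r : R => r ^+ 2)); [exact: cf|exact: exprn_continuous].
Qed.

Lemma sobolev_field : sobolev_H1 h V (fun a b => partial b (V a)).
Proof.
have sV a : smooth_cyl (V a) by exact: field_smooth_cyl.
split=> [a|a b|a b f tf].
- exact/square_integrable_continuous/smooth_cyl_continuous.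
- exact/square_integrable_continuous/smooth_cyl_continuous/smooth_cyl_partial.
- have sf : smooth_cyl f by case: tf.
  apply: integration_by_parts => //; [exact: C1_smooth_cyl..|by case: (sV a)|by case: sf|].
  by right; right; exact: test_interior_vanishes.
Qed.

(** In the pairing with v, every integration by parts across the width meets
    either a sine wave or the normal component of v, and both vanish on the
    boundary. *)
Lemma traction_field (v : vfield) : (forall a, smooth_cyl (v a)) -> tangential h v ->
  traction_trace h lam mu (fun a b => partial b (V a)) (fun a x => L * V a x) v = 0.
Proof.
move=> sv tv; have vv : vanishes h (v 1).
  move=> x; split.
    have := tv (x, 0) (or_introl erefl); rewrite sum2 /normal /= eqxx mul0r add0r mulN1r.
    by move=> /eqP; rewrite oppr_eq0 => /eqP.
  have := tv (x, h) (or_intror erefl); rewrite sum2 /normal /= (gt_eqF h0) mul0r add0r.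
  by rewrite mul1r.
have iM s' c f : smooth_cyl f -> cyl_integrable h (fun p => wave h s' c n k p * f p).
  by move=> sf; apply: integrableM2 => //; exact: smooth_cyl_continuous.
have sv' a b : smooth_cyl (partial b (v a)) by exact: smooth_cyl_partial.
have sgF : sg false = -1 :> R by [].
have sgT : sg true = 1 :> R by [].
have T1 : I (fun p => X p * partial 0 (v 0) p) = en * I (fun p => U p * v 0 p).
  by rewrite (wave_ibp0 _ _ _ _ _ _ h0 (sv 0)) negbK sgN /en; ring.
have T2 : I (fun p => X p * partial 1 (v 1) p) = ka * I (fun p => W p * v 1 p).
  by rewrite (wave_ibp1 _ _ _ _ _ _ h0 (sv 1) (or_intror vv)) sgF mulN1r opprK.
have T3 : I (fun p => Y p * partial 1 (v 0) p) = - ka * I (fun p => U p * v 0 p).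
  by rewrite (wave_ibp1 _ _ _ _ _ _ h0 (sv 0) (or_introl erefl)) sgT mul1r.
have T4 : I (fun p => Y p * partial 0 (v 1) p) = - en * I (fun p => W p * v 1 p).
  by rewrite (wave_ibp0 _ _ _ _ _ _ h0 (sv 1)).
have {}T1 : has_integral _ _ _ := conj (iM (~~ s) false _ (sv' 0 0)) T1.
have {}T2 : has_integral _ _ _ := conj (iM (~~ s) false _ (sv' 1 1)) T2.
have {}T3 : has_integral _ _ _ := conj (iM s true _ (sv' 0 1)) T3.
have {}T4 : has_integral _ _ _ := conj (iM s true _ (sv' 1 0)) T4.
have S0 := has_integral_self (iM s false _ (sv 0)).
have S1 := has_integral_self (iM (~~ s) true _ (sv 1)).
have H := has_integralD (has_integralZ (lam * d + 2 * mu * en * A) T1)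
  (has_integralD (has_integralZ (lam * d + 2 * mu * ka * B) T2)
  (has_integralD (has_integralZ (- mu * (A * ka + B * en)) T3)
  (has_integralD (has_integralZ (- mu * (A * ka + B * en)) T4)
  (has_integralD (has_integralZ (- (L * A)) S0)
                 (has_integralZ (- (L * B)) S1))))).
apply: has_integral_val; apply: (has_integral_eq H) => [p|].
  rewrite (stress_contract lam mu (fun c d => partial d (V c) p)
    (fun a b => partial b (v a) p)).
  rewrite (sum2 (fun a => L * V a p * v a p)) D00 D01 D10 D11 V0 V1.
  rewrite -/U -/W -/X -/Y; move: (U p) (W p) (X p) (Y p) (v 0 p) (v 1 p) (partial 0 (v 0) p)
    (partial 1 (v 0) p) (partial 0 (v 1) p) (partial 1 (v 1) p) => u w x y v0 v1 a1 a2 a3 a4.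
  by rewrite /d; ring.
rewrite -eqA -eqB.
move: (cyl_integral h _) (cyl_integral h _) => u w.
by rewrite /d -en2; ring.
Qed.

Lemma normal_trace_field f : smooth_cyl f ->
  normal_trace h V (fun a b => partial b (V a)) f = 0.
Proof.
move=> sf.
have iM s' c g : smooth_cyl g -> cyl_integrable h (fun p => wave h s' c n k p * g p).
  by move=> sg; apply: integrableM2 => //; exact: smooth_cyl_continuous.
have sf' b : smooth_cyl (partial b f) by exact: smooth_cyl_partial.
have sgT : sg true = 1 :> R by [].
have T1 : I (fun p => U p * partial 0 f p) = - en * I (fun p => X p * f p).
  exact: wave_ibp0.
have T2 : I (fun p => W p * partial 1 f p) = - ka * I (fun p => X p * f p).
  by rewrite (wave_ibp1 _ _ _ _ _ _ h0 sf (or_introl erefl)) sgT mul1r.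
have {}T1 : has_integral _ _ _ := conj (iM s false _ (sf' 0)) T1.
have {}T2 : has_integral _ _ _ := conj (iM (~~ s) true _ (sf' 1)) T2.
have S0 := has_integral_self (iM (~~ s) false _ sf).
have H := has_integralD (has_integralZ d S0)
  (has_integralD (has_integralZ A T1) (has_integralZ B T2)).
apply: has_integral_val; apply: (has_integral_eq H) => [p|].
  rewrite !sum2 D00 D11 V0 V1 /=.
  rewrite -/U -/W -/X; move: (U p) (W p) (X p) (f p) (partial 0 f p) (partial 1 f p) => u w x v0 a1 a2.
  by rewrite /d; ring.
by rewrite -/X; move: (cyl_integral h _) => u; rewrite /d; ring.
Qed.

Lemma field_FD_solution : FD_solution h lam mu L V.
Proof.
exists (fun a b => partial b (V a)); split.
- exact: sobolev_field.
- exact: weak_elasticity_field.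
- exact: traction_field.
- exact: normal_trace_field.
Qed.

End FieldIsSolution.

End Modes.

(** * Orthogonality of the waves *)

Section Orthogonality.
Context {R : realType}.
Variable h : R.
Hypothesis h0 : 0 < h.

Let sE := @wave_smooth_cyl R h.

Definition pairing (f g : R * R -> R) : R := cyl_integral h (fun p => f p * g p).

Lemma pairingC f g : pairing f g = pairing g f.
Proof. by apply: eq_cyl_integral => p; rewrite mulrC. Qed.

Lemma pairingZr (c : R) f g : continuous f -> continuous g ->
  pairing f (fun p => c * g p) = c * pairing f g.
Proof.
move=> cf cg; apply: has_integral_val.
apply: (has_integral_eq (has_integralZ c (has_integral_self (integrableM2 _ _ _ h0 cf cg)))) => // p.
exact: mulrCA.
Qed.

Lemma kap_inj : injective (kap h).
Proof.
move=> k k' /(congr1 ( *%R^~ h)); rewrite /kap !divfK ?gt_eqF //.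
by move=> /mulIf; rewrite gt_eqF ?pi_gt0 // => /(_ isT)/eqP; rewrite eqr_nat => /eqP.
Qed.

Lemma kap_gt0 k : (0 < k)%N -> 0 < kap h k.
Proof. by move=> k0; rewrite /kap divr_gt0 // mulr_gt0 ?pi_gt0 // ltr0n. Qed.

Lemma kap_ge0 k : 0 <= kap h k.
Proof. by rewrite /kap divr_ge0 ?(ltW h0) // mulr_ge0 // pi_ge0. Qed.

Lemma kap0 : kap h 0 = 0. Proof. by rewrite /kap !mul0r. Qed.

Let wave_ibp0' s c n k f : smooth_cyl f ->
  pairing (wave h s c n k) (partial 0 f) = - (sg s * n%:R) * pairing (wave h (~~ s) c n k) f.
Proof. by move=> sf; exact: wave_ibp0. Qed.

Let wave_ibp1' s c n k f : smooth_cyl f -> c = true \/ vanishes h f ->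
  pairing (wave h s c n k) (partial 1 f) = - (sg c * kap h k) * pairing (wave h s (~~ c) n k) f.
Proof. by move=> sf cf; exact: wave_ibp1. Qed.

Let wave_partial0' s c n k f : continuous f ->
  pairing f (partial 0 (wave h s c n k)) = sg s * n%:R * pairing f (wave h (~~ s) c n k).
Proof. by move=> cf; rewrite partial0_wave pairingZr //; exact: wave_continuous. Qed.

Let wave_partial1' s c n k f : continuous f ->
  pairing f (partial 1 (wave h s c n k)) = sg c * kap h k * pairing f (wave h s (~~ c) n k).
Proof. by move=> cf; rewrite partial1_wave pairingZr //; exact: wave_continuous. Qed.

Let vanishes_flip s c n k : c = true \/ vanishes h (wave h s (~~ c) n k).
Proof. by case: c; [left|right; exact: wave_vanishes]. Qed.

Let vanishes_partial s c n k : c = true \/ vanishes h (partial 1 (wave h s c n k)).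
Proof.
case: c; [by left|right; rewrite partial1_wave => x].
by have [-> ->] := wave_vanishes h s n k h0 x; rewrite !mulr0.
Qed.

(** Waves with different n are eigenfunctions of the symmetric operator d_1 d_1
    for different eigenvalues. *)
Lemma wave_orthogonal_freq0 s s' c c' n n' k k' : n != n' ->
  pairing (wave h s c n k) (wave h s' c' n' k') = 0.
Proof.
move=> nn'; set J := pairing _ _.
have cE := wave_continuous h.
have : pairing (wave h s c n k) (partial 0 (partial 0 (wave h s' c' n' k'))) = - n%:R ^+ 2 * J.
  rewrite wave_ibp0'; last exact: smooth_cyl_partial.
  by rewrite wave_ibp0' // negbK sgN -/J; case: (s); rewrite /sg; ring.
rewrite partial0_wave.
rewrite (partialZ 0 _ _ (C1_smooth_cyl _ (wave_smooth_cyl h (~~ s') c' n' k'))) pairingZr //; last first.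
  exact/smooth_cyl_continuous/smooth_cyl_partial.
rewrite wave_partial0' // negbK -/J sgN => H.
have : (n%:R ^+ 2 - n'%:R ^+ 2) * J = 0 :> R.
  suff /eqP : - (n'%:R ^+ 2) * J = - (n%:R ^+ 2) * J.
    by rewrite !mulNr eqr_opp mulrBl => /eqP ->; rewrite subrr.
  by rewrite -H; case: (s'); rewrite /sg; ring.
move=> /eqP; rewrite mulf_eq0 subr_eq0 eqrXn2 ?ler0n // eqr_nat (negbTE nn') /=.
by move/eqP.
Qed.

(** As for n, now with d_2 d_2; the boundary terms vanish because the two waves
    have the same parity c in x2. *)
Lemma wave_orthogonal_freq1 s s' c n n' k k' : k != k' ->
  pairing (wave h s c n k) (wave h s' c n' k') = 0.
Proof.
move=> kk'; set J := pairing _ _.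
have cE := wave_continuous h.
have : pairing (wave h s c n k) (partial 1 (partial 1 (wave h s' c n' k'))) = - kap h k ^+ 2 * J.
  rewrite wave_ibp1'; [|exact: smooth_cyl_partial|exact: vanishes_partial].
  rewrite wave_ibp1' //; last by case: (c); [right; exact: wave_vanishes|left].
  by rewrite negbK sgN -/J; case: (c); rewrite /sg; ring.
rewrite partial1_wave.
rewrite (partialZ 1 _ _ (C1_smooth_cyl _ (wave_smooth_cyl h s' (~~ c) n' k'))) pairingZr //; last first.
  exact/smooth_cyl_continuous/smooth_cyl_partial.
rewrite wave_partial1' // negbK -/J sgN => H.
have : (kap h k ^+ 2 - kap h k' ^+ 2) * J = 0 :> R.
  suff /eqP : - (kap h k' ^+ 2) * J = - (kap h k ^+ 2) * J.
    by rewrite !mulNr eqr_opp mulrBl => /eqP ->; rewrite subrr.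
  by rewrite -H; case: (c); rewrite /sg; ring.
move=> /eqP; rewrite mulf_eq0 subr_eq0 eqrXn2 ?kap_ge0 // (inj_eq kap_inj) (negbTE kk') /=.
by move/eqP.
Qed.

Lemma wave_sin0 c k : wave h true c 0 k = fun=> 0.
Proof. by apply/funext => p; rewrite /wave /tensor /trig mul0r sin0 mul0r. Qed.

Lemma wave_sink0 s n : wave h s true n 0 = fun=> 0.
Proof.
by apply/funext => p; rewrite /wave /tensor /trig kap0 mul0r sin0 mulr0.
Qed.

Lemma pairing0 f : pairing f (fun=> 0) = 0.
Proof.
rewrite /pairing (_ : (fun p => _) = fun=> 0); last by apply/funext => p; rewrite mulr0.
by rewrite /cyl_integral Rintegral_cst ?mul0r //; exact: measurable_cylinder.
Qed.

(** The derivative d_1 is antisymmetric and exchanges the two waves up to a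
    factor, so the pairing equals its own opposite. *)
Lemma wave_orthogonal_parity s c n k : pairing (wave h s c n k) (wave h (~~ s) c n k) = 0.
Proof.
have cE := wave_continuous h.
have [->|n0] := posnP n.
  by case: s; [rewrite pairingC|]; rewrite wave_sin0 pairing0.
have := wave_ibp0' s c n k _ (sE s c n k); rewrite wave_partial0' // [in RHS]pairingC => /eqP.
rewrite -subr_eq0 mulNr opprK -mulr2n mulrn_eq0 /= !mulf_eq0 (negbTE (sg_neq0 s)) pnatr_eq0.
by rewrite (gtn_eqF n0) => /eqP.
Qed.

Lemma wave_orthogonal s s' c n n' k k' : (s, n, k) != (s', n', k') ->
  pairing (wave h s c n k) (wave h s' c n' k') = 0.
Proof.
move=> ne; have [nn|nn] := eqVneq n n'; last exact: wave_orthogonal_freq0.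
have [kk|kk] := eqVneq k k'; last exact: wave_orthogonal_freq1.
subst n' k'; have -> : s' = ~~ s; last exact: wave_orthogonal_parity.
by case: s s' ne => -[] //; rewrite eqxx.
Qed.

Let Q s c n k := pairing (wave h s c n k) (wave h s c n k).

Lemma wave_norm_flip0 s c n k : (0 < n)%N -> Q (~~ s) c n k = Q s c n k.
Proof.
move=> n0; have cE := wave_continuous h.
have := wave_ibp0' s c n k _ (sE (~~ s) c n k); rewrite wave_partial0' // negbK -/(Q _ _ _ _) sgN.
rewrite -/(Q (~~ s) _ _ _) !mulNr => /oppr_inj/mulfI ->//.
by rewrite mulf_neq0 ?sg_neq0 // pnatr_eq0 -lt0n.
Qed.

Lemma wave_norm_flip1 s c n k : (0 < k)%N -> Q s (~~ c) n k = Q s c n k.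
Proof.
move=> k0; have cE := wave_continuous h.
have := wave_ibp1' s c n k _ (sE s (~~ c) n k) (vanishes_flip _ _ _ _).
rewrite wave_partial1' // negbK -/(Q _ _ _ _) sgN.
rewrite -/(Q _ (~~ c) _ _) !mulNr => /oppr_inj/mulfI ->//.
by rewrite mulf_neq0 ?sg_neq0 // gt_eqF // kap_gt0.
Qed.

(** For the positivity of the norms, sin^2 + cos^2 = 1 replaces the evaluation of
    integrals: together with the equality of the norms of a wave and
    its flipped version it brings every norm back to the area of the cylinder. *)
Lemma wave_norm_add0 c n k : Q false c n k + Q true c n k = Q false c 0 k.
Proof.
have cE := wave_continuous h; apply/esym/has_integral_val.
have i s := has_integral_self (integrableM2 _ _ _ h0 (cE s c n k) (cE s c n k)).
apply: (has_integral_eq (has_integralD (i false) (i true))) => // -[x y].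
rewrite /wave /tensor /=; move: (trig c (kap h k) y) => t; rewrite /trig mul0r cos0 mul1r.
have := cos2Dsin2 (n%:R * x); move: (cos _) (sin _) => a b ab.
by rewrite -[RHS]mul1r -ab; ring.
Qed.

Lemma wave_norm_add1 s n k : Q s false n k + Q s true n k = Q s false n 0.
Proof.
have cE := wave_continuous h; apply/esym/has_integral_val.
have i c := has_integral_self (integrableM2 _ _ _ h0 (cE s c n k) (cE s c n k)).
apply: (has_integral_eq (has_integralD (i false) (i true))) => // -[x y].
rewrite /wave /tensor /=; move: (trig s n%:R x) => t; rewrite /trig kap0 mul0r cos0 mulr1.
have := cos2Dsin2 (kap h k * y); move: (cos _) (sin _) => a b ab.
by rewrite -[RHS]mul1r -ab; ring.
Qed.

Lemma wave_norm_gt0 s c n k : (0 < n)%N || ~~ s -> (0 < k)%N || ~~ c -> 0 < Q s c n k.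
Proof.
have base : 0 < Q false false 0 0.
  rewrite /Q /pairing (_ : (fun p => _) = fun=> 1).
    rewrite /cyl_integral Rintegral_cst; last exact: measurable_cylinder.
    by rewrite mul1r lebesgue2_cylinder ?(ltW h0) //= !mulr_gt0 // pi_gt0.
  by apply/funext => p; rewrite /wave /tensor /trig /= kap0 !mul0r cos0 !mulr1.
have baseN s' n' : (0 < n')%N || ~~ s' -> 0 < Q s' false n' 0.
  have [->|n0 _] := posnP n'; first by case: s'.
  have := base; rewrite -(wave_norm_add0 false n' 0) -(wave_norm_flip0 true) //= => H.
  by have := wave_norm_flip0 s' false n' 0 n0; case: s' => /= H2; lra.
move=> ns; have [->|k0 _] := posnP k; first by case: c => // _; exact: baseN.
have := baseN _ _ ns; rewrite -(wave_norm_add1 s n k).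
by have := wave_norm_flip1 s c n k k0; case: c => /= ->; lra.
Qed.

End Orthogonality.

(** * Solutions tested against waves *)

Section WeakSolutions.
Context {R : realType}.
Variable h : R.
Hypothesis h0 : 0 < h.
Notation TT := (measurableTypeR R * measurableTypeR R)%type.
Implicit Types (f g : R * R -> R).

Let mC := @measurable_cylinder R h.
Let h0' : 0 <= h := ltW h0.

Lemma cyl_integrable_measurable f : cyl_integrable h f -> measurable_fun (cylinder h) (f : TT -> R).
Proof. by move=> /(measurable_int _)/measurable_EFinP. Qed.

Lemma square_integrable_integrable f : square_integrable h f -> cyl_integrable h f.
Proof.
move=> [mf f2].
have i1 : lebesgue2.-integrable (cylinder h) (EFin \o (fun=> 1 : R) : TT -> \bar R).
  by apply: integrable_continuous => // p; exact: cvg_cst.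
apply: (le_integrable mC _ _ (integrableD mC i1 f2)); first exact/measurable_EFinP.
move=> p _; rewrite /= lee_fin.
have a0 : 0 <= 1 + f p ^+ 2 by rewrite addr_ge0 // sqr_ge0.
rewrite [leRHS]ger0_norm // -real_normK ?num_real //.
by have := sqr_ge0 (`|f p| - 1); have := normr_ge0 (f p); nra.
Qed.

Lemma cyl_integrableM f g (M : R) : cyl_integrable h f ->
  measurable_fun (cylinder h) (g : TT -> R) ->
  (forall p, cylinder h p -> `|g p| <= M) -> cyl_integrable h (fun p => f p * g p).
Proof.
move=> fi mg gM; apply: (integrableMl mC fi mg).
by exists M; split; [exact: num_real|move=> y My p /gM/le_trans; apply; exact: ltW].
Qed.

Lemma cyl_integrableM_continuous f g : cyl_integrable h f -> continuous g ->
  cyl_integrable h (fun p => f p * g p).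
Proof.
move=> fi cg; have [M _ gM] := bounded_cylinder h g cg.
apply: (cyl_integrableM _ _ M) => //.
exact: (measurable_funTS (continuous_measurable2 _ cg)).
Qed.

(** The boundary has measure zero, so convergence of the cutoffs inside the
    cylinder is enough. *)
Lemma null_line (r : R) : lebesgue2.-negligible ([set p | p.2 = r] : set TT).
Proof.
have E : [set p | p.2 = r] = (setT : set (measurableTypeR R)) `*` [set r].
  by apply/seteqP; split => -[x y] //= [].
have m1 : measurable ([set r] : set (measurableTypeR R)) by exact: measurable_set1.
apply/negligibleP; first by rewrite E; exact: measurableX.
rewrite E; apply: etrans (lebesgue2X _ _ (measurableT) m1) _.
by rewrite [X in (_ * X)%E]lebesgue_measure_set1 mule0.
Qed.

Let mEM f g : measurable_fun (cylinder h) (f : TT -> R) ->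
  measurable_fun (cylinder h) (g : TT -> R) ->
  measurable_fun (cylinder h : set TT) (fun p : TT => (f p * g p)%:E).
Proof. by move=> mf mg; apply/measurable_EFinP; exact: measurable_funM. Qed.

Lemma cyl_dominated (w : R * R -> R) (phi_ : nat -> R * R -> R) (phi : R * R -> R) (C : R) :
  cyl_integrable h w ->
  (forall m, measurable_fun (cylinder h) (phi_ m : TT -> R)) ->
  measurable_fun (cylinder h) (phi : TT -> R) ->
  (forall m p, cylinder h p -> `|phi_ m p| <= C) ->
  (forall p, cylinder h p -> 0 < p.2 < h -> phi_ m p @[m --> \oo] --> phi p) ->
  cyl_integral h (fun p => w p * phi_ m p) @[m --> \oo] -->
  cyl_integral h (fun p => w p * phi p).
Proof.
move=> wi mphi_ mphi phiC cphi; have mw := cyl_integrable_measurable _ wi.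
have [|||||ilim _] := @dominated_convergence _ TT R lebesgue2 (cylinder h) mC
  (fun m p => (w p * phi_ m p)%:E) (fun p => (w p * phi p)%:E) (fun p => (`|w p| * C)%:E).
- by move=> m; exact: (mEM _ _ mw (mphi_ m)).
- exact: (mEM _ _ mw mphi).
- have := negligibleU (null_line 0) (null_line h).
  apply: negligibleS => -[x y] /= H; apply: contrapT => /not_orP[/= y0 yh]; apply: H.
  move=> Cp; apply: cvg_EFin; first exact: nearW.
  apply: cvgM; first exact: cvg_cst.
  apply: cphi => //=; case: Cp => _ /=; rewrite in_itv /= => /andP[a b].
  by rewrite !lt_neqAle a b eq_sym; move/eqP: y0 => ->; move/eqP: yh => ->.
- have := integrableZr mC C (integrable_norm wi).
  exact.
- apply/aeW => p m Cp; rewrite /= lee_fin normrM ler_wpM2l //; exact: phiC.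
move=> H.
have i : cyl_integrable h (fun p => w p * phi p) by [].
apply: fine_cvg; rewrite fineK; last exact: (integrable_fin_num mC i).
exact: H.
Qed.

Lemma trig_lipschitz (c : bool) (w x y : R) : 0 <= w -> x <= y ->
  `|trig c w y - trig c w x| <= w * (y - x).
Proof.
move=> w0 xy.
have [|z _ ->] := @MVT_segment R (trig c w) _ _ _ xy (fun z _ => is_derive_trig c w z).
  by apply: continuous_subspaceT; exact: (smooth1_continuous _ (smooth1_trig c w)).
rewrite normrM (ger0_norm (_ : 0 <= y - x)) ?subr_ge0 //.
rewrite ler_wpM2r ?subr_ge0 // !normrM (ger0_norm w0).
have -> : `|sg c| = 1 :> R by case: (c); rewrite /sg ?normrN normr1.
by rewrite mul1r ler_piMr // /trig; case: (~~ c); rewrite ?sin_max ?cos_max.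
Qed.

Lemma wave_increment s c n k (x y z : R) : y <= z ->
  `|wave h s c n k (x, z) - wave h s c n k (x, y)| <= kap h k * (z - y).
Proof.
move=> yz; rewrite /wave /tensor /= -mulrBr normrM -[leRHS]mul1r ler_pM //.
  by rewrite /trig; case: (s); rewrite ?sin_max ?cos_max.
by apply: trig_lipschitz => //; exact: kap_ge0.
Qed.

(** The weak gradient is tested against the wave times a cutoff, and the cutoff is
    removed by dominated convergence.  For d_1 the cutoff is not differentiated;
    for d_2 its derivative is multiplied by a sine, which vanishes linearly on the
    boundary ([dchi_bound]). *)
Lemma sobolev_ibp u Du (a b : 'I_2) s c n k : sobolev_H1 h u Du -> b = 0 \/ c = true ->
  cyl_integral h (fun p => Du a b p * wave h s c n k p) =
  - cyl_integral h (fun p => u a p * partial b (wave h s c n k) p).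
Proof.
move=> [su sDu wg] bc; set e := wave h s c n k.
have ui := square_integrable_integrable _ (su a).
have Di := square_integrable_integrable _ (sDu a b).
have mc f : continuous f -> measurable_fun (cylinder h) (f : TT -> R).
  by move=> cf; exact: (measurable_funTS (continuous_measurable2 _ cf)).
have ce : continuous e by exact: wave_continuous.
have ce' : continuous (partial b e).
  exact/smooth_cyl_continuous/smooth_cyl_partial/wave_smooth_cyl.
pose f_ m := tensor (trig s n%:R) (fun y => trig c (kap h k) y * chi h m y).
have f_E m p : f_ m p = e p * chi h m p.2 by rewrite /f_ /tensor /e /wave /tensor mulrA.
have sf_ m : smooth_cyl (f_ m).
  split.
    apply: tensor_smooth; first exact: smooth1_trig.
    by move=> N; apply: diff_uptoM; [exact: smooth1_trig|exact: smooth1_chi].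
  move=> x y; rewrite !f_E; congr (_ * _).
  by have [_] := wave_smooth_cyl h s c n k; apply.
have tf_ m : test_interior h (f_ m).
  split => //; exists m.+1%:R^-1; first by rewrite invr_gt0.
  by move=> x y H; rewrite f_E /= chi_eq0 // mulr0.
have [Me Me0 HMe] := bounded_cylinder h e ce.
have [Mb Mb0 HMb] := bounded_cylinder h (partial b e) ce'.
have chi1 m (y : R) : `|chi h m y| <= 1.
  by have /andP[c0 c1] := chi_01 h m y; rewrite ger0_norm.
have lim1 (z y : R) : 0 < y < h -> z * chi h m y @[m --> \oo] --> z.
  by move=> yh; have := cvgM (cvg_cst z) (cvg_chi _ _ yh); rewrite mulr1; apply.
have cv1 : cyl_integral h (fun p => Du a b p * f_ m p) @[m --> \oo] -->
    cyl_integral h (fun p => Du a b p * e p).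
  apply: (cyl_dominated _ _ _ Me) => //.
  - by move=> m; apply: mc; exact: smooth_cyl_continuous.
  - exact: mc.
  - move=> m p Cp; rewrite f_E normrM -[leRHS]mulr1.
    by apply: ler_pM => //; exact: HMe.
  - move=> p Cp p2; rewrite (_ : (fun m => f_ m p) = fun m => e p * chi h m p.2).
      exact: lim1.
    by apply/funext => m; exact: f_E.
(* The part of the derivative of the product where the cutoff is differentiated. *)
pose de m p := if b == 0 then 0 else e p * dchi h m p.2.
have f_'E m p : partial b (f_ m) p = partial b e p * chi h m p.2 + de m p.
  rewrite /de /e /f_ /wave; elim/ord2P: b {Di cv1 HMb ce' wg de f_E sf_ tf_ bc Mb Mb0 sDu} => /=.
    rewrite !partial0_tensor => [|x|x]; try exact/smooth1_derivable/smooth1_trig.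
    by rewrite /tensor addr0 mulrA.
  have dprod (y : R) : is_derive y 1 (fun y => trig c (kap h k) y * chi h m y)
      (trig c (kap h k) y * dchi h m y + chi h m y * derive1 (trig c (kap h k)) y).
    rewrite derive1_trig.
    exact: (is_deriveM (is_derive_trig _ _ _) (is_derive_chi _ _ _)).
  rewrite !partial1_tensor => [|y|y]; last 2 first.
  - exact/smooth1_derivable/smooth1_trig.
  - by have [] := dprod y.
  by rewrite (derive1_is _ _ dprod) /tensor; ring.
have [Cd HCd] : exists C : R, forall m p, cylinder h p -> `|de m p| <= C.
  rewrite /de; case: eqP bc => [_ _|b0 [//|c1]]; first by exists 0 => m p _; rewrite normr0.
  have k0 := kap_ge0 h h0 k.
  exists (10 * kap h k) => m p [_ /=].
  rewrite in_itv /= => y0h; apply: dchi_bound => //.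
    have [E0 _] := wave_vanishes h s n k h0 p.1; case/andP: y0h => y0 _.
    have := wave_increment s true n k p.1 0 p.2 y0; rewrite E0 !subr0 /e c1.
    by case: (p).
  have [_ E1] := wave_vanishes h s n k h0 p.1; case/andP: y0h => _ yh.
  have := wave_increment s true n k p.1 p.2 h yh; rewrite E1 sub0r normrN /e c1.
  by case: (p).
have cv2 : cyl_integral h (fun p => u a p * partial b (f_ m) p) @[m --> \oo] -->
    cyl_integral h (fun p => u a p * partial b e p).
  apply: (cyl_dominated _ _ _ (Mb + Cd)) => //.
  - by move=> m; apply: mc; exact/smooth_cyl_continuous/smooth_cyl_partial.
  - exact: mc.
  - move=> m p Cp; rewrite f_'E (le_trans (ler_normD _ _)) // lerD //; last exact: HCd.
    by rewrite normrM -[leRHS]mulr1; apply: ler_pM => //; exact: HMb.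
  - move=> p Cp p2; rewrite (_ : (fun m => _) = fun m => partial b e p * chi h m p.2 + de m p); last first.
      by apply/funext => m; exact: f_'E.
    have lim2 : de m p @[m --> \oo] --> (0 : R).
      rewrite /de; case: (b == 0); first exact: cvg_cst.
      by have := cvgM (cvg_cst (e p)) (cvg_dchi _ _ p2); rewrite mulr0; apply.
    by have := cvgD (lim1 (partial b e p) _ p2) lim2; rewrite addr0; apply.
have cv3 : - cyl_integral h (fun p => Du a b p * f_ m p) @[m --> \oo] -->
    cyl_integral h (fun p => u a p * partial b e p).
  by under eq_fun do rewrite -wg //.
apply: oppr_inj; rewrite opprK -(cvg_lim (@Rhausdorff R) cv3).
by apply/esym/cvg_lim => //; exact: (cvgN cv1).
Qed.

(** The normal trace is the integral of (div u) f + u . grad f.  The terms with d_1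
    cancel by [sobolev_ibp], so its vanishing is the integration by parts in x2,
    even though a cosine does not vanish on the boundary. *)
Lemma sobolev_normal_ibp u Du s k n : sobolev_H1 h u Du ->
  (forall f, smooth_cyl f -> normal_trace h u Du f = 0) ->
  cyl_integral h (fun p => Du 1 1 p * wave h s false n k p) =
  - cyl_integral h (fun p => u 1 p * partial 1 (wave h s false n k) p).
Proof.
move=> hu nu; set e := wave h s false n k; have [su sDu _] := hu.
have se : smooth_cyl e by exact: wave_smooth_cyl.
have ce := smooth_cyl_continuous _ se.
have ce' b := smooth_cyl_continuous _ (smooth_cyl_partial b _ se).
have D0 := sobolev_ibp u Du 0 0 s false n k hu (or_introl erefl).
have iD a : cyl_integrable h (fun p => Du a a p * e p).
  by apply: cyl_integrableM_continuous => //; exact: square_integrable_integrable.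
have iu a : cyl_integrable h (fun p => u a p * partial a e p).
  by apply: cyl_integrableM_continuous => //; exact: square_integrable_integrable.
have [_ I0] := has_integralD
  (has_integralD (has_integral_self (iD 0)) (has_integral_self (iD 1)))
  (has_integralD (has_integral_self (iu 0)) (has_integral_self (iu 1))).
have := nu e se; rewrite /normal_trace.
rewrite [X in X = 0 -> _](_ : _ = cyl_integral h (fun p =>
   Du 0 0 p * e p + Du 1 1 p * e p + (u 0 p * partial 0 e p + u 1 p * partial 1 e p))); last first.
  by apply: eq_cyl_integral => p; rewrite !sum2 mulrDl.
rewrite I0 D0 -/e; set x := cyl_integral h _; set y := cyl_integral h _; set z := cyl_integral h _.
clearbody x y z => H; apply/eqP; rewrite -addr_eq0 -[X in _ == X]H; apply/eqP.
by ring.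
Qed.

Definition dot (u v : vfield) : R := cyl_integral h (fun p => \sum_(a < 2) u a p * v a p).

Lemma dot_field u s n k A B : (forall a, cyl_integrable h (u a)) ->
  dot u (wave_field h s n k A B) =
  A * cyl_integral h (fun p => u 0 p * wave h s false n k p) +
  B * cyl_integral h (fun p => u 1 p * wave h (~~ s) true n k p).
Proof.
move=> iu; apply: has_integral_val.
have i a s' c := has_integral_self (cyl_integrableM_continuous _ _ (iu a)
  (wave_continuous h s' c n k)).
apply: (has_integral_eq (has_integralD (has_integralZ A (i 0 _ _)) (has_integralZ B (i 1 _ _)))) => // p.
by rewrite sum2 /wave_field /= mulrCA [X in _ + X]mulrCA.
Qed.

(** The field V is an admissible test field in the traction condition for u.
    Integrating by parts, the stress of u against the gradient of V becomes u
    against the operator applied to V, that is L' <u, V>; the condition says that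
    it equals L <u, V>. *)
Lemma solution_dot_field lam mu L L' u s n k A B :
  let ka := kap h k in let en := sg s * n%:R in let d := en * A + ka * B in
  mu * (n%:R ^+ 2 + ka ^+ 2) * A + (lam + mu) * en * d = L' * A ->
  mu * (n%:R ^+ 2 + ka ^+ 2) * B + (lam + mu) * ka * d = L' * B ->
  FD_solution h lam mu L u -> (L' - L) * dot u (wave_field h s n k A B) = 0.
Proof.
move=> ka en d eqA eqB [Du [hu _ tu nu]].
have [su sDu _] := hu.
set V := wave_field h s n k A B.
have sV a : smooth_cyl (V a) by exact: field_smooth_cyl.
have tV : tangential h V.
  move=> [x y] /= yb; rewrite sum2 /normal /= mul0r add0r.
  rewrite /V /wave_field /= (_ : wave h (~~ s) true n k (x, y) = 0) ?mulr0 //.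
  by have [E0 E1] := wave_vanishes h (~~ s) n k h0 x; case: yb => /= ->.
have := tu V sV tV; rewrite /traction_trace.
set alpha := cyl_integral h (fun p => u 0 p * wave h s false n k p).
set beta := cyl_integral h (fun p => u 1 p * wave h (~~ s) true n k p).
have -> : dot u V = A * alpha + B * beta.
  by apply: dot_field => a; exact: square_integrable_integrable.
have iM f s' c : square_integrable h f -> cyl_integrable h (fun p => f p * wave h s' c n k p).
  move=> sf; apply: cyl_integrableM_continuous; last exact: wave_continuous.
  exact: square_integrable_integrable.
have u_partial0 a s' c : cyl_integral h (fun p => u a p * partial 0 (wave h s' c n k) p) =
    sg s' * n%:R * cyl_integral h (fun p => u a p * wave h (~~ s') c n k p).
  apply: has_integral_val; rewrite partial0_wave.
  apply: (has_integral_eq (has_integralZ (sg s' * n%:R) (has_integral_self (iM _ _ _ (su a))))) => // p.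
  exact: mulrCA.
have u_partial1 a s' c : cyl_integral h (fun p => u a p * partial 1 (wave h s' c n k) p) =
    sg c * ka * cyl_integral h (fun p => u a p * wave h s' (~~ c) n k p).
  apply: has_integral_val; rewrite partial1_wave.
  apply: (has_integral_eq (has_integralZ (sg c * ka) (has_integral_self (iM _ _ _ (su a))))) => // p.
  exact: mulrCA.
have sgF : sg false = -1 :> R by [].
have sgT : sg true = 1 :> R by [].
have T0 : cyl_integral h (fun p => Du 0 0 p * wave h (~~ s) false n k p) = en * alpha.
  rewrite (sobolev_ibp u Du 0 0 (~~ s) false n k hu (or_introl erefl)) u_partial0 negbK sgN.
  by rewrite !mulNr opprK.
have T1 : cyl_integral h (fun p => Du 1 1 p * wave h (~~ s) false n k p) = ka * beta.
  by rewrite (sobolev_normal_ibp u Du (~~ s) k n hu nu) u_partial1 sgF mulN1r mulNr opprK.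
have T2 : cyl_integral h (fun p => Du 0 1 p * wave h s true n k p) = - ka * alpha.
  by rewrite (sobolev_ibp u Du 0 1 s true n k hu (or_intror erefl)) u_partial1 sgT mul1r mulNr.
have T3 : cyl_integral h (fun p => Du 1 0 p * wave h s true n k p) = - en * beta.
  by rewrite (sobolev_ibp u Du 1 0 s true n k hu (or_introl erefl)) u_partial0 mulNr.
have {}T0 : has_integral _ _ _ := conj (iM _ (~~ s) false (sDu 0 0)) T0.
have {}T1 : has_integral _ _ _ := conj (iM _ (~~ s) false (sDu 1 1)) T1.
have {}T2 : has_integral _ _ _ := conj (iM _ s true (sDu 0 1)) T2.
have {}T3 : has_integral _ _ _ := conj (iM _ s true (sDu 1 0)) T3.
have S0 := has_integral_self (iM _ s false (su 0)).
have S1 := has_integral_self (iM _ (~~ s) true (su 1)).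
have H := has_integralD (has_integralZ (lam * d + 2 * mu * en * A) T0)
  (has_integralD (has_integralZ (lam * d + 2 * mu * ka * B) T1)
  (has_integralD (has_integralZ (- mu * (A * ka + B * en)) T2)
  (has_integralD (has_integralZ (- mu * (A * ka + B * en)) T3)
  (has_integralD (has_integralZ (- (L * A)) S0)
                 (has_integralZ (- (L * B)) S1))))).
have VA b : partial b (V 0) = fun p => A * partial b (wave h s false n k) p.
  by rewrite -(partialZ b A _ (C1_smooth_cyl _ (wave_smooth_cyl h s false n k))).
have VB b : partial b (V 1) = fun p => B * partial b (wave h (~~ s) true n k) p.
  by rewrite -(partialZ b B _ (C1_smooth_cyl _ (wave_smooth_cyl h (~~ s) true n k))).
have -> := has_integral_val (has_integral_eq H (_ : _ =1 _) erefl).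
  rewrite -/alpha -/beta => Z; rewrite mulrBl.
  have -> : L' * (A * alpha + B * beta) = (L' * A) * alpha + (L' * B) * beta by ring.
  rewrite -eqA -eqB -[RHS]Z /d.
  have -> : n%:R ^+ 2 = en * en by rewrite /en mulrACA sg_sqr mul1r.
  by ring.
move=> p; rewrite (stress_contract lam mu (fun c d => Du c d p)
    (fun a b => partial b (V a) p)).
rewrite (sum2 (fun a => L * u a p * V a p)) !VA !VB !partial0_wave !partial1_wave negbK sgN sgF sgT -/ka.
rewrite /V /wave_field /=.
move: (Du _ _ _) (Du _ _ _) (Du _ _ _) (Du _ _ _) (u _ _) (u _ _) => D00 D01 D10 D11 u0 u1.
move: (wave _ _ _ _ _ _) (wave _ _ _ _ _ _) (wave _ _ _ _ _ _) (wave _ _ _ _ _ _) => e0 e1 e2 e3.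
by rewrite /d /en; ring.
Qed.

End WeakSolutions.

(** * Polynomials approximating a step *)

Section Threshold.
Context {R : realType}.

(** With K = (N+1) 2^(N+1), the value is (1 - t^(N+1))^K, and K t^(N+1) is
    (N+1) (2t)^(N+1).  It tends to 0 for t < 1/2, so that the value tends to 1, and
    to infinity for t >= 1/2, so that the value tends to 0. *)
Definition threshold (N : nat) (t : R) : R := (1 - t ^+ N.+1) ^+ (N.+1 * 2 ^ N.+1).

Lemma threshold_01 N (t : R) : 0 <= t <= 1 -> 0 <= threshold N t <= 1.
Proof.
move=> /andP[t0 t1]; have tN : 0 <= t ^+ N.+1 <= 1 by rewrite exprn_ge0 // exprn_ile1.
have /andP[a b] := tN; rewrite /threshold exprn_ge0 ?subr_ge0 //= exprn_ile1 ?subr_ge0 //.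
by rewrite lerBlDr lerDl.
Qed.

Lemma bernoulli_ge (t : R) n : 0 <= t -> 1 + n%:R * t <= (1 + t) ^+ n.
Proof.
move=> t0; elim: n => [|n IH]; first by rewrite mul0r addr0 expr0.
rewrite exprS; apply: (le_trans _ (ler_wpM2l _ IH)); last by rewrite addr_ge0.
rewrite -natr1; set m := n%:R; have m0 : 0 <= m :> R by rewrite ler0n.
have : 0 <= m * (t * t) by rewrite !mulr_ge0.
by lra.
Qed.

Lemma bernoulli_le (t : R) n : 0 <= t <= 1 -> 1 - n%:R * t <= (1 - t) ^+ n.
Proof.
move=> /andP[t0 t1]; elim: n => [|n IH]; first by rewrite mul0r subr0 expr0.
rewrite exprS; apply: (le_trans _ (ler_wpM2l _ IH)); last by rewrite subr_ge0.
rewrite -natr1; set m := n%:R; have m0 : 0 <= m :> R by rewrite ler0n.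
have : 0 <= m * (t * t) by rewrite !mulr_ge0.
by lra.
Qed.

Lemma threshold_ge_half N (t : R) : 1 / 2 <= t <= 1 -> threshold N t <= N.+1%:R^-1.
Proof.
move=> /andP[t2 t1]; have t0 : 0 <= t by lra.
set K := (N.+1 * 2 ^ N.+1)%N; set r := t ^+ N.+1.
have r01 : 0 <= r <= 1 by rewrite exprn_ge0 // exprn_ile1.
have /andP[r0 r1] := r01.
have rge : 2 ^- N.+1 <= r.
  rewrite -exprVn /r lerXn2r ?nnegrE ?invr_ge0 //.
  by move: t2; rewrite div1r.
have KN : N.+1%:R <= K%:R * r.
  rewrite /K natrM natrX -mulrA ler_peMr // mulrC -ler_pdivrMr ?exprn_gt0 //.
  by rewrite div1r.
have N0 : 0 < N.+1%:R :> R by rewrite ltr0n.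
(* By Bernoulli, (1 + r)^K is at least K r, so (1 - r)^K is at most 1 / (K r). *)
have H : (1 - r) ^+ K * (1 + r) ^+ K <= 1.
  rewrite -exprMn exprn_ile1 //; first by rewrite mulr_ge0 ?subr_ge0 // addr_ge0.
  by rewrite -subr_sqr expr1n lerBlDr lerDl sqr_ge0.
have H2 := bernoulli_ge _ K r0.
have q0 : 0 <= (1 - r) ^+ K by rewrite exprn_ge0 // subr_ge0.
rewrite -[threshold N t]/((1 - r) ^+ K) -div1r ler_pdivlMr //.
apply: (le_trans _ H); rewrite ler_wpM2l //; apply: (le_trans _ H2).
by apply: (le_trans KN); rewrite lerDr.
Qed.

Lemma threshold_lt_half N (t : R) : 0 <= t < 1 / 2 ->
  1 - N.+1%:R * (2 * t) ^+ N.+1 <= threshold N t.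
Proof.
move=> /andP[t0 t2].
have H : 0 <= t ^+ N.+1 <= 1 by rewrite exprn_ge0 // exprn_ile1 //; lra.
apply: le_trans (bernoulli_le _ _ H).
by rewrite natrM natrX -mulrA -exprMn.
Qed.

(** With s the square root of r, the factor N s^N is bounded by 1 / (1 - s), and
    the other factor s^N is geometric. *)
Lemma cvg_natr_expr (r : R) : 0 <= r < 1 -> N.+1%:R * r ^+ N.+1 @[N --> \oo] --> (0 : R).
Proof.
move=> /andP[r0 r1]; set s := Num.sqrt r.
have s0 : 0 <= s by exact: sqrtr_ge0.
have s2 : s * s = r by rewrite -expr2 sqr_sqrtr.
have s1 : s < 1 by rewrite -(ltr_pXn2r (ltn0Sn 1)) ?nnegrE // expr1n expr2 s2.
set d := 1 - s; have d0 : 0 < d by rewrite subr_gt0.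
have bound N : N%:R * s ^+ N <= d^-1.
  have H : s ^+ N * (1 + d) ^+ N <= 1.
    have d1 : d <= 1 by rewrite /d lerBlDr lerDl.
    have -> : s = 1 - d by rewrite /d; ring.
    rewrite -exprMn -subr_sqr expr1n exprn_ile1 //.
      by rewrite subr_ge0 exprn_ile1 // ltW.
    by rewrite lerBlDr lerDl sqr_ge0.
  have B := bernoulli_ge d N (ltW d0).
  have sN : 0 <= s ^+ N by rewrite exprn_ge0.
  rewrite -div1r ler_pdivlMr // mulrAC mulrC.
  apply: (le_trans _ H); rewrite ler_wpM2l //; apply: le_trans B.
  by rewrite lerDr.
have sg0 : d^-1 * s ^+ N.+1 @[N --> \oo] --> (0 : R).
  have := @cvg_geometric R (d^-1 * s) s; rewrite ger0_norm // => /(_ s1).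
  rewrite (_ : (fun N => _) = geometric (d^-1 * s) s) //.
  by apply/funext => N; rewrite /geometric /= exprS mulrA.
apply: (squeeze_cvgr _ (cvg_cst 0) sg0); apply: nearW => N.
rewrite mulr_ge0 ?exprn_ge0 //= -s2 exprMn mulrA ler_wpM2r ?exprn_ge0 //.
Qed.

Lemma cvg_threshold (t : R) : 0 <= t <= 1 ->
  threshold N t @[N --> \oo] --> (((t < 1 / 2)%R)%:R : R).
Proof.
move=> t01; have /andP[t0 t1] := t01; case: ltP => t2.
  have H : 1 - N.+1%:R * (2 * t) ^+ N.+1 @[N --> \oo] --> (1 : R).
    rewrite -[X in _ --> X]subr0; apply: cvgB; first exact: cvg_cst.
    by apply: cvg_natr_expr; rewrite mulr_ge0 //=; lra.
  rewrite /= mulr1n; apply: (squeeze_cvgr _ H (cvg_cst (1 : R))); apply: nearW => N.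
  rewrite threshold_lt_half ?t0 //=.
  by have /andP[] := threshold_01 N _ t01.
rewrite /= mulr0n; apply: (squeeze_cvgr _ (cvg_cst (0 : R)) (@cvg_harmonic R)); apply: nearW => N.
have /andP[-> _] /= := threshold_01 N _ t01.
by apply: threshold_ge_half; rewrite t2.
Qed.

End Threshold.

(** * Trigonometric polynomials *)

Section TrigonometricPolynomials.
Context {R : realType}.
Variable h : R.
Hypothesis h0 : 0 < h.
Implicit Types (f g : R * R -> R).

Inductive trigpoly : (R * R -> R) -> Prop :=
| trigpolyE s n k : trigpoly (wave h s false n k)
| trigpolyD f g : trigpoly f -> trigpoly g -> trigpoly (fun p => f p + g p)
| trigpolyZ (c : R) f : trigpoly f -> trigpoly (fun p => c * f p).

(** Multipliers rather than products of trigonometric polynomials: it suffices to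
    know that cos x1, sin x1 and cos (pi x2 / h) multiply waves into combinations of
    waves, and everything polynomial in them follows. *)
Definition multiplier f := forall g, trigpoly g -> trigpoly (fun p => f p * g p).

Lemma trigpoly_eq f g : trigpoly f -> f =1 g -> trigpoly g.
Proof. by move=> + /funext <-. Qed.

Lemma trigpoly1 : trigpoly (fun=> 1).
Proof.
apply: (trigpoly_eq _ _ (trigpolyE false 0 0)) => p.
by rewrite /wave /tensor /trig kap0 !mul0r cos0 mulr1.
Qed.

Lemma trigpoly_continuous f : trigpoly f -> continuous f.
Proof.
elim=> [s n k|u v _ cu _ cv|c u _ cu]; first exact: wave_continuous.
  by move=> p; apply: cvgD; [exact: cu|exact: cv].
by move=> p; apply: cvgM; [exact: cvg_cst|exact: cu].
Qed.

Lemma multiplierD f g : multiplier f -> multiplier g -> multiplier (fun p => f p + g p).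
Proof.
move=> mf mg u tu; apply: (trigpoly_eq _ _ (trigpolyD _ _ (mf _ tu) (mg _ tu))) => p.
by rewrite mulrDl.
Qed.

Lemma multiplierZ (c : R) f : multiplier f -> multiplier (fun p => c * f p).
Proof.
by move=> mf u tu; apply: (trigpoly_eq _ _ (trigpolyZ c _ (mf _ tu))) => p; rewrite mulrA.
Qed.

Lemma multiplierM f g : multiplier f -> multiplier g -> multiplier (fun p => f p * g p).
Proof.
by move=> mf mg u tu; apply: (trigpoly_eq _ _ (mf _ (mg _ tu))) => p; rewrite mulrA.
Qed.

Lemma multiplier_cst (c : R) : multiplier (fun=> c).
Proof. by move=> u tu; exact: trigpolyZ. Qed.

Lemma multiplierX f n : multiplier f -> multiplier (fun p => f p ^+ n).
Proof.
move=> mf; elim: n => [|n IH]; first by under eq_fun do rewrite expr0; exact: multiplier_cst.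
by under eq_fun do rewrite exprS; exact: multiplierM.
Qed.

Lemma multiplier_threshold N f : multiplier f -> multiplier (fun p => threshold N (f p)).
Proof.
move=> mf; apply: multiplierX; rewrite (_ : (fun p => _) = fun p => 1 + (-1) * f p ^+ N.+1).
  apply: multiplierD; first exact: multiplier_cst.
  by apply: multiplierZ; exact: multiplierX.
by apply/funext => p; rewrite mulN1r.
Qed.

Lemma multiplier_wave f : (forall s n k, trigpoly (fun p => f p * wave h s false n k p)) ->
  multiplier f.
Proof.
move=> fE u; elim=> [s n k|v w _ tv _ tw|c v _ tv]; first exact: fE.
  by apply: (trigpoly_eq _ _ (trigpolyD _ _ tv tw)) => p; rewrite mulrDr.
by apply: (trigpoly_eq _ _ (trigpolyZ c _ tv)) => p; rewrite mulrCA.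
Qed.

Let half (c : R) f g : trigpoly f -> trigpoly g -> trigpoly (fun p => 1 / 2 * f p + c * g p).
Proof. by move=> tf tg; apply: trigpolyD; exact: trigpolyZ. Qed.

Let natrS (n : nat) (x : R) : n.+1%:R * x = n%:R * x + x.
Proof. by rewrite -natr1 mulrDl mul1r. Qed.

Lemma multiplier_cosx : multiplier (fun p => cos p.1).
Proof.
apply: multiplier_wave => s [|n] k.
  case: s; last first.
    apply: (trigpoly_eq _ _ (trigpolyE false 1 k)) => -[x y].
    by rewrite /wave /tensor /trig /= mul1r mul0r cos0 mul1r.
  apply: (trigpoly_eq _ _ (trigpolyE true 0 k)) => -[x y].
  by rewrite /wave /tensor /trig /= mul0r sin0 mul0r mulr0.
apply: (trigpoly_eq _ _ (half (1/2) _ _ (trigpolyE s n.+2 k) (trigpolyE s n k))) => -[x y].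
rewrite /wave /tensor /=; move: (trig false (kap h k) y) => t; rewrite /trig.
have nx : n%:R * x = n.+1%:R * x - x by rewrite natrS addrK.
by case: s; rewrite (natrS n.+1) nx ?cosD ?sinD ?cosN ?sinN; field.
Qed.

Lemma multiplier_sinx : multiplier (fun p => sin p.1).
Proof.
apply: multiplier_wave => s [|n] k.
  case: s; last first.
    apply: (trigpoly_eq _ _ (trigpolyE true 1 k)) => -[x y].
    by rewrite /wave /tensor /trig /= mul1r mul0r cos0 mul1r.
  apply: (trigpoly_eq _ _ (trigpolyE true 0 k)) => -[x y].
  by rewrite /wave /tensor /trig /= mul0r sin0 mul0r mulr0.
have nx (x : R) : n%:R * x = n.+1%:R * x - x by rewrite natrS addrK.
case: s.
  apply: (trigpoly_eq _ _ (trigpolyD _ _ (trigpolyZ (-1/2) _ (trigpolyE false n.+2 k))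
    (trigpolyZ (1/2) _ (trigpolyE false n k)))) => -[x y].
  rewrite /wave /tensor /=; move: (trig false (kap h k) y) => t; rewrite /trig.
  by rewrite (natrS n.+1) nx ?cosD ?sinD ?cosN ?sinN; field.
apply: (trigpoly_eq _ _ (trigpolyD _ _ (trigpolyZ (1/2) _ (trigpolyE true n.+2 k))
  (trigpolyZ (-1/2) _ (trigpolyE true n k)))) => -[x y].
rewrite /wave /tensor /=; move: (trig false (kap h k) y) => t; rewrite /trig.
by rewrite (natrS n.+1) nx ?cosD ?sinD ?cosN ?sinN; field.
Qed.

Let kapS k : kap h k.+1 = kap h k + kap h 1.
Proof. by rewrite /kap -natr1; field; rewrite gt_eqF. Qed.

Lemma multiplier_cosy : multiplier (fun p => cos (kap h 1 * p.2)).
Proof.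
apply: multiplier_wave => s n [|k].
  apply: (trigpoly_eq _ _ (trigpolyE s n 1)) => -[x y].
  by rewrite /wave /tensor /trig /= kap0 mul0r cos0 mulr1 mulrC.
apply: (trigpoly_eq _ _ (half (1/2) _ _ (trigpolyE s n k.+2) (trigpolyE s n k))) => -[x y].
rewrite /wave /tensor /=; move: (trig s n%:R x) => t; rewrite /trig.
have ky : kap h k * y = kap h k.+1 * y - kap h 1 * y by rewrite (kapS k) mulrDl addrK.
by rewrite (kapS k.+1) ky mulrDl ?cosD ?cosN ?sinN; field.
Qed.

End TrigonometricPolynomials.

(** * Completeness of the waves *)

Section Completeness.
Context {R : realType}.
Variable h : R.
Hypothesis h0 : 0 < h.
Notation TT := (measurableTypeR R * measurableTypeR R)%type.
Implicit Types (f g : R * R -> R) (A B S : set (R * R)).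

Let mC := @measurable_cylinder R h.

(** Bounded pointwise limits of trigonometric polynomials on the cylinder; the
    bound [0, 1] is what dominated convergence asks for. *)
Definition approximable A := exists m_ : nat -> R * R -> R,
  [/\ forall N, multiplier h (m_ N),
      forall N p, cylinder h p -> 0 <= m_ N p <= 1 &
      forall p, cylinder h p -> m_ N p @[N --> \oo] --> (\1_A p : R)].

Lemma approximable_cst A (b : bool) : (forall p, cylinder h p -> A p <-> b) -> approximable A.
Proof.
move=> Ab; exists (fun _ _ => b%:R); split.
- by move=> N; exact: multiplier_cst.
- by move=> N p _; case: (b); rewrite ?ler01 ?lexx.
- move=> p /Ab Apb; rewrite indicE (_ : (p \in A) = b); first exact: cvg_cst.
  by apply/idP/idP; rewrite inE => /Apb.
Qed.

Lemma approximable_threshold A f : multiplier h f ->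
  (forall p, cylinder h p -> 0 <= f p <= 1) ->
  (forall p, cylinder h p -> A p <-> f p < 1 / 2) -> approximable A.
Proof.
move=> mf f01 Af; exists (fun N p => threshold N (f p)); split.
- by move=> N; exact: multiplier_threshold.
- by move=> N p /f01; exact: threshold_01.
- move=> p Cp; rewrite indicE (_ : (p \in A) = (f p < 1 / 2)); last first.
    by apply/idP/idP; rewrite inE => /(Af p Cp).
  exact/cvg_threshold/f01.
Qed.

Let multiplier_half g (c : R) : multiplier h g ->
  multiplier h (fun p => 1 / 2 + 1 / 4 * (g p + c)).
Proof.
move=> mg; apply: multiplierD; first exact: multiplier_cst.
by apply: multiplierZ; apply: multiplierD => //; exact: multiplier_cst.
Qed.

Let cos_half (a b : R) : 0 <= 1 / 2 + 1 / 4 * (cos a + - cos b) <= 1.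
Proof.
have := cos_le1 a; have := cos_geN1 a; have := cos_le1 b; have := cos_geN1 b.
by move=> *; apply/andP; split; lra.
Qed.

(** On the circle, cos (x1 - b/2) < cos (b/2) describes the arc ]b, 2 pi[: the
    difference of the two cosines is - 2 sin (x1/2) sin ((x1 - b)/2), whose first
    sine is nonnegative.  An affine map brings the comparison to the level 1/2. *)
Lemma approximable_fst (b : R) : approximable [set p | b < p.1].
Proof.
have pi2 : 0 < pi :> R by exact: pi_gt0.
have [b0|b0] := ltP b 0.
  apply: (approximable_cst _ true) => -[x y] [/= + _].
  by rewrite in_itv /= => /andP[x0 _]; split=> // _; exact: lt_le_trans x0.
have [b1|b1] := leP (2 * pi) b.
  apply: (approximable_cst _ false) => -[x y] [/= + _].
  rewrite in_itv /= => /andP[_ x1]; split=> // bx.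
  by have := lt_trans (le_lt_trans b1 bx) x1; rewrite ltxx.
apply: (approximable_threshold _ (fun p => 1 / 2 + 1 / 4 * (cos (p.1 - b / 2) + - cos (b / 2)))).
- apply: multiplier_half.
  rewrite (_ : (fun p => _) = fun p => cos (b / 2) * cos p.1 + sin (b / 2) * sin p.1).
    by apply: multiplierD; apply: multiplierZ; [exact: multiplier_cosx|exact: multiplier_sinx].
  by apply/funext => p; rewrite cosB mulrC [X in _ + X]mulrC.
- by move=> p _; exact: cos_half.
- move=> [x y] [/= + _]; rewrite in_itv /= => /andP[x0 x1].
  have E : cos (x - b / 2) + - cos (b / 2) = - (2 * (sin (x / 2) * sin ((x - b) / 2))).
    rewrite (_ : x - b / 2 = x / 2 + (x - b) / 2); last by field.
    rewrite [X in _ + - cos X](_ : b / 2 = x / 2 - (x - b) / 2); last by field.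
    by rewrite cosD cosB; ring.
  rewrite E; have sx : 0 <= sin (x / 2) by apply: sin_ge0_pi; lra.
  split=> [bx|H].
    have s1 : 0 < sin (x / 2) by apply: sin_gt0_pi; lra.
    have s2 : 0 < sin ((x - b) / 2) by apply: sin_gt0_pi; lra.
    by have := mulr_gt0 s1 s2; lra.
  rewrite ltNge; apply/negP => xb.
  have s2 : 0 <= sin ((b - x) / 2) by apply: sin_ge0_pi; lra.
  have := mulr_ge0 sx s2; rewrite (_ : (b - x) / 2 = - ((x - b) / 2)); last by field.
  by rewrite sinN; lra.
Qed.

(** The cosine of pi x2 / h decreases across the width, so comparing cosines is
    comparing heights. *)
Lemma approximable_snd (d : R) : approximable [set p | d < p.2].
Proof.
have [d0|d0] := ltP d 0.
  apply: (approximable_cst _ true) => -[x y] [/= _].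
  by rewrite in_itv /= => /andP[y0 _]; split=> // _; exact: lt_le_trans y0.
have [d1|d1] := leP h d.
  apply: (approximable_cst _ false) => -[x y] [/= _].
  rewrite in_itv /= => /andP[_ y1]; split=> // dy.
  by have := lt_le_trans (le_lt_trans d1 dy) y1; rewrite ltxx.
have kpi (z : R) : 0 <= z <= h -> kap h 1 * z \in `[0, pi].
  move=> /andP[z0 z1]; rewrite in_itv /= mulr_ge0 ?kap_ge0 //= /kap mul1r.
  by rewrite mulrAC ler_pdivrMr // ler_wpM2l // pi_ge0.
apply: (approximable_threshold _ (fun p => 1 / 2 + 1 / 4 *
  (cos (kap h 1 * p.2) + - cos (kap h 1 * d)))).
- by apply: multiplier_half; exact: multiplier_cosy.
- by move=> p _; exact: cos_half.
- move=> [x y] [/= _]; rewrite in_itv /= => y01.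
  have -> : (d < y) = (cos (kap h 1 * y) < cos (kap h 1 * d)).
    rewrite ltr_cos ?ltr_pM2l ?kap_gt0 //; apply: kpi => //.
    by rewrite d0 ltW.
  by split=> H; lra.
Qed.

Section Annihilated.
Variable f : R * R -> R.
Hypothesis fi : cyl_integrable h f.
Hypothesis f_orth : forall s n k, cyl_integral h (fun p => f p * wave h s false n k p) = 0.

Lemma trigpoly_orthogonal g : trigpoly h g -> cyl_integral h (fun p => f p * g p) = 0.
Proof.
have i u : trigpoly h u -> cyl_integrable h (fun p => f p * u p).
  by move=> /trigpoly_continuous cu; exact: cyl_integrableM_continuous.
elim=> [s n k|u v tu Iu tv Iv|c u tu Iu]; first exact: f_orth.
  apply: has_integral_val.
  apply: (has_integral_eq (has_integralD (conj (i _ tu) Iu) (conj (i _ tv) Iv))); last exact: addr0.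
  by move=> p; rewrite mulrDr.
apply: has_integral_val.
apply: (has_integral_eq (has_integralZ c (conj (i _ tu) Iu))); last exact: mulr0.
by move=> p; rewrite mulrCA.
Qed.

Let null S : Prop := (\int[lebesgue2]_(x in cylinder h `&` S) (f x)%:E = 0)%E.

Let integrable_cap S : measurable (S : set TT) ->
  lebesgue2.-integrable (cylinder h `&` S : set TT) (EFin \o f).
Proof.
move=> mS; apply: (integrableS mC) => //; first exact: measurableI.
Qed.

(** The products of the approximating polynomials converge boundedly to the
    indicator of the intersection, and f is orthogonal to each of them. *)
Lemma null_approximable A B : measurable (A : set TT) -> measurable (B : set TT) ->
  approximable A -> approximable B -> null (A `&` B).
Proof.
move=> mA mB [a_ [ma a01 acvg]] [b_ [mb b01 bcvg]].
have mAB : measurable (A `&` B : set TT) by exact: measurableI.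
have cab N : continuous (fun p => a_ N p * b_ N p).
  apply: trigpoly_continuous.
  apply: (trigpoly_eq _ _ _ (multiplierM _ _ _ (ma N) (mb N) _ (trigpoly1 h))) => p.
  exact: mulr1.
have : cyl_integral h (fun p => f p * (a_ N p * b_ N p)) @[N --> \oo] -->
    cyl_integral h (fun p => f p * \1_(A `&` B) p).
  apply: (cyl_dominated h f _ _ 1) => //.
  - by move=> N; exact: (measurable_funTS (continuous_measurable2 _ (cab N))).
  - move=> N p Cp; have /andP[a0 a1] := a01 N _ Cp; have /andP[b0 b1] := b01 N _ Cp.
    by rewrite ger0_norm ?mulr_ge0 // -[leRHS]mulr1 ler_pM.
  - move=> p Cp _; rewrite indicI; exact: (cvgM (acvg _ Cp) (bcvg _ Cp)).
have z N : cyl_integral h (fun p => f p * (a_ N p * b_ N p)) = 0.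
  apply: trigpoly_orthogonal.
  apply: (trigpoly_eq _ _ _ (multiplierM _ _ _ (ma N) (mb N) _ (trigpoly1 h))) => p.
  exact: mulr1.
under eq_fun do rewrite z.
move=> /(cvg_unique (@Rhausdorff R) (cvg_cst 0)) I0.
rewrite /null integral_mkcondr -[LHS]fineK.
  congr (_%:E); rewrite [RHS]I0 /cyl_integral /Rintegral; congr fine.
  apply: eq_integral => p _; rewrite epatch_indic /=.
  by [].
rewrite -integral_mkcondr; apply: integrable_fin_num => //; [exact: measurableI|exact: integrable_cap].
Qed.

Let quadrants : set (set TT) :=
  [set S | exists b d : R, S = [set p | b < p.1] `&` [set p | d < p.2]].

Let mfst (b : R) : measurable ([set p | b < p.1] : set TT).
Proof.
rewrite (_ : [set p | _] = `]b, +oo[ `*` setT); first exact: measurableX.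
by apply/seteqP; split=> -[x y] /=; rewrite in_itv /= andbT => // -[].
Qed.

Let msnd (d : R) : measurable ([set p | d < p.2] : set TT).
Proof.
rewrite (_ : [set p | _] = setT `*` `]d, +oo[); first exact: measurableX.
by apply/seteqP; split=> -[x y] /=; rewrite in_itv /= andbT => // -[].
Qed.

(** A half-plane is the countable union of the quadrants whose other bound is
    a negative integer or 0, so the quadrants generate both coordinates. *)
Lemma measurable_quadrants : @measurable _ TT = <<s quadrants >>.
Proof.
apply/seteqP; split; last first.
  apply: smallest_sub; first exact: sigma_algebra_measurable.
  by move=> _ [b [d ->]]; exact: measurableI.
pose T' := g_sigma_algebraType quadrants.
have cover (z : R) : exists n : nat, - n%:R < z.
  by case: (@nbhs_infty_ger R (1 - z)) => n _ /(_ n (leqnn n)) /= H; exists n; lra.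
have mf : measurable_fun setT (fst : T' -> R).
  apply: (measurability _ (RGenOInfty.measurableE R)) => _ [_ [b ->] <-].
  rewrite setTI (_ : _ @^-1` _ = \bigcup_n ([set p | b < p.1] `&` [set p | - n%:R < p.2])).
    by apply: bigcup_measurable => n _; apply: sub_sigma_algebra; exists b, (- n%:R).
  apply/seteqP; split=> [[x y] /=|[x y] [n _ [/= + _]]]; rewrite in_itv /= andbT // => bx.
  by have [n yn] := cover y; exists n.
have ms : measurable_fun setT (snd : T' -> R).
  apply: (measurability _ (RGenOInfty.measurableE R)) => _ [_ [d ->] <-].
  rewrite setTI (_ : _ @^-1` _ = \bigcup_n ([set p | - n%:R < p.1] `&` [set p | d < p.2])).
    by apply: bigcup_measurable => n _; apply: sub_sigma_algebra; exists (- n%:R), d.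
  apply/seteqP; split=> [[x y] /=|[x y] [n _ [/= _]]]; rewrite in_itv /= andbT // => dy.
  by have [n xn] := cover x; exists n.
rewrite measurable_prod_measurableType; apply: smallest_sub; first exact: smallest_sigma_algebra.
move=> _ [A mA] [B mB] <-.
rewrite (_ : A `*` B = ((fst : T' -> R) @^-1` A) `&` ((snd : T' -> R) @^-1` B)) //.
apply: (@measurableI _ T').
  by rewrite -[X in measurable X]setTI; exact: mf.
by rewrite -[X in measurable X]setTI; exact: ms.
Qed.

(** The sets of zero integral form a Dynkin system, which contains the quadrants,
    a class stable under intersection. *)
Lemma null_measurable S : measurable (S : set TT) -> null S.
Proof.
have nT : null setT.
  rewrite -[setT]setIid; apply: null_approximable => //; exact: (approximable_cst _ true).
move=> mS; apply: (@dynkin_induction _ TT quadrants null measurable_quadrants).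
- move=> _ _ [b [d ->]] [b' [d' ->]]; exists (Num.max b b'), (Num.max d d').
  by apply/seteqP; split=> -[x y] /=; rewrite !gt_max;
    [move=> [[-> ->] [-> ->]]|move=> [/andP[-> ->] /andP[-> ->]]].
- exact: nT.
- move=> _ [b [d ->]]; apply: null_approximable => //;
    [exact: approximable_fst|exact: approximable_snd].
- move=> A mA nA; have mCA : measurable (~` A : set TT) by exact: measurableC.
  have E : cylinder h `&` setT = (cylinder h `&` A) `|` (cylinder h `&` ~` A) :> set TT.
    by rewrite -setIUr setUv.
  have := nT; rewrite /null E integral_setU //=; [|exact: measurableI..| |].
  - by rewrite nA add0e.
  - by rewrite -E; exact: (measurable_int _ (integrable_cap _ measurableT)).
  - by apply/disj_set2P; rewrite setIACA setICr setI0.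
- move=> F mF tF nF; rewrite /null setI_bigcupr integral_bigcup.
  + by rewrite eseries0 // => n _ _; exact: nF.
  + by apply: trivIset_setIl.
  + by move=> n; exact: measurableI.
  + by rewrite -setI_bigcupr; apply: integrable_cap; exact: bigcup_measurable.
- by rewrite -measurable_quadrants.
Qed.

Lemma orthogonal_cos_eq0 : ae_eq lebesgue2 (cylinder h) f (fun=> 0).
Proof.
have : ae_eq lebesgue2 (cylinder h) (EFin \o f : TT -> \bar R) (fun=> 0%E).
  apply: (integral_ae_eq mC fi) => [|S SC mS]; first exact: measurable_cst.
  by rewrite integral0 -[S](setIidr SC); exact: null_measurable.
by apply: filterS => p + Cp => /(_ Cp) /= [].
Qed.

End Annihilated.

(** A product of sin (pi x2 / h) with a cosine in x2 is a combination of sines in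
    x2, so f sin (pi x2 / h) is orthogonal to the waves with cosines and vanishes by
    [orthogonal_cos_eq0]; the factor sin (pi x2 / h) is positive off the boundary. *)
Lemma orthogonal_sin_eq0 f : cyl_integrable h f ->
  (forall s n k, cyl_integral h (fun p => f p * wave h s true n k p) = 0) ->
  ae_eq lebesgue2 (cylinder h) f (fun=> 0).
Proof.
move=> fi f_orth; set e := wave h false true 0 1.
have ce : continuous e by exact: wave_continuous.
have fe : cyl_integrable h (fun p => f p * e p) by exact: cyl_integrableM_continuous.
have : ae_eq lebesgue2 (cylinder h) (fun p => f p * e p) (fun=> 0).
  apply: orthogonal_cos_eq0 => // s n k.
  have i c j : has_integral h (fun p => f p * wave h s c n j p)
      (cyl_integral h (fun p => f p * wave h s c n j p)).
    by apply: has_integral_self; apply: cyl_integrableM_continuous => //; exact: wave_continuous.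
  case: k => [|k].
    rewrite -[RHS](f_orth s n 1); apply: eq_cyl_integral => -[x y].
    by rewrite /e /wave /tensor /trig /= kap0 !mul0r cos0; case: (s); ring.
  apply: has_integral_val.
  apply: (has_integral_eq (has_integralD (has_integralZ (1/2) (i true k.+2))
    (has_integralZ (-1/2) (i true k)))); last first.
    by rewrite !f_orth !mulr0 addr0.
  move=> [x y]; rewrite /e /wave /tensor /=; move: (trig s n%:R x) => t; rewrite /trig.
  have kS j : kap h j.+1 = kap h j + kap h 1 by rewrite /kap -natr1; field; rewrite gt_eqF.
  have ky : kap h k * y = kap h k.+1 * y - kap h 1 * y by rewrite (kS k) mulrDl addrK.
  by rewrite (kS k.+1) ky mulrDl mul0r cos0 ?sinD ?cosN ?sinN; field.
have off_boundary : {ae lebesgue2, forall p : TT, ~ (p.2 = 0 \/ p.2 = h)}.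
  by apply: negligibleS (negligibleU (null_line 0) (null_line h)) => p /= /contrapT.
move=> fe0; move: fe0 off_boundary; apply: filterS2 => -[x y] /= + /not_orP[/eqP y0 /eqP yh] Cp.
move=> /(_ Cp) /eqP; rewrite mulf_eq0 => /orP[/eqP //|/eqP sin0'].
case: Cp => _ /=; rewrite in_itv /= => /andP[y0' yh'].
have ypos : 0 < y by rewrite lt_neqAle eq_sym y0.
have ylt : y < h by rewrite lt_neqAle yh.
have : 0 < sin (kap h 1 * y).
  apply: sin_gt0_pi; apply/andP; split; first by rewrite mulr_gt0 ?kap_gt0.
  by rewrite /kap mul1r mulrAC ltr_pdivrMr // ltr_pM2l ?pi_gt0.
by move: sin0'; rewrite /e /wave /tensor /trig /= mul0r cos0 mul1r => ->; rewrite ltxx.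
Qed.

End Completeness.

(** * The modes *)

Section ModeBasis.
Context {R : realType}.
Variables (h lam mu : R).
Hypotheses (h0 : 0 < h) (mu0 : 0 < mu) (lm0 : 0 < lam + mu).
Notation TT := (measurableTypeR R * measurableTypeR R)%type.

(** A mode (c, s, n, k) has frequencies n and k and parity s in x1; it is
    divergence-free when c holds and a gradient otherwise. *)
Definition mode := (bool * bool * nat * nat)%type.

(** The amplitudes of a gradient are the vector xi = (+- n, ka), those of a
    divergence-free mode the orthogonal vector.  At n = k = 0, where xi vanishes,
    the value 1 encodes the translation along the circle. *)
Definition amplitude0 (j : mode) : R := let: (c, s, n, k) := j in
  if c then if (n == 0)%N && (k == 0)%N then 1 else kap h k else sg s * n%:R.

Definition amplitude1 (j : mode) : R := let: (c, s, n, k) := j in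
  if c then - (sg s * n%:R) else kap h k.

Definition mode_field (j : mode) : vfield := let: (c, s, n, k) := j in
  wave_field h s n k (amplitude0 j) (amplitude1 j).

Definition mode_eigenvalue (j : mode) : R := let: (c, s, n, k) := j in
  (n%:R ^+ 2 + kap h k ^+ 2) * (if c then mu else lam + 2 * mu).

(** The modes whose field is not zero: at n = 0 the waves with a sine in x1 vanish
    and at k = 0 those with a sine in x2, so one of the two components, or both,
    must survive with a nonzero amplitude. *)
Definition nontrivial (j : mode) : bool := let: (c, s, n, k) := j in
  if c then (0 < n)%N && (0 < k)%N || (n == 0)%N && ~~ s
  else (0 < n)%N || s && (0 < k)%N.

Let mode_equations (j : mode) : let: (c, s, n, k) := j in
  let A := amplitude0 j in let B := amplitude1 j in let L := mode_eigenvalue j in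
  let d := sg s * n%:R * A + kap h k * B in
  mu * (n%:R ^+ 2 + kap h k ^+ 2) * A + (lam + mu) * (sg s * n%:R) * d = L * A /\
  mu * (n%:R ^+ 2 + kap h k ^+ 2) * B + (lam + mu) * kap h k * d = L * B.
Proof.
case: j => [[[c s] n] k] /=; have s2 := @sg_sqr R s.
have n2 : (sg s * n%:R) * (sg s * n%:R) = n%:R ^+ 2 :> R by rewrite mulrACA s2 mul1r.
case: c; last by rewrite n2 -n2; split; ring.
case: ifP => [/andP[/eqP -> /eqP ->]|_]; last by split; ring.
by rewrite kap0; split; ring.
Qed.

Lemma mode_solution j : FD_solution h lam mu (mode_eigenvalue j) (mode_field j).
Proof.
have := mode_equations j; case: j => [[[c s] n] k] [eqA eqB].
exact: field_FD_solution.
Qed.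

Lemma solution_orthogonal_mode L u j : FD_solution h lam mu L u -> mode_eigenvalue j != L ->
  dot h u (mode_field j) = 0.
Proof.
move=> su jL; have := mode_equations j; case: j jL => [[[c s] n] k] jL [eqA eqB].
have /eqP := solution_dot_field h h0 lam mu L _ u s n k _ _ eqA eqB su.
by rewrite mulf_eq0 subr_eq0 (negbTE jL) => /eqP.
Qed.

Lemma mode_field_continuous j a : continuous (mode_field j a).
Proof.
case: j => [[[c s] n] k]; apply: smooth_cyl_continuous.
exact: field_smooth_cyl.
Qed.

Lemma mode_square_integrable j a : square_integrable h (mode_field j a).
Proof. exact/square_integrable_continuous/mode_field_continuous. Qed.

Let dot_modes c s n k c' s' n' k' : dot h (mode_field (c, s, n, k)) (mode_field (c', s', n', k')) =
  amplitude0 (c', s', n', k') * (amplitude0 (c, s, n, k) *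
    pairing h (wave h s false n k) (wave h s' false n' k')) +
  amplitude1 (c', s', n', k') * (amplitude1 (c, s, n, k) *
    pairing h (wave h (~~ s) true n k) (wave h (~~ s') true n' k')).
Proof.
rewrite [in LHS]/mode_field -/(mode_field (c, s, n, k)) dot_field //; last first.
  by move=> a; exact: (square_integrable_integrable h h0 _ (mode_square_integrable (c, s, n, k) a)).
have i A t t' b : has_integral h (fun p => A * wave h t b n k p * wave h t' b n' k' p)
    (A * pairing h (wave h t b n k) (wave h t' b n' k')).
  have := has_integralZ A (has_integral_self (integrableM2 h _ _ h0
    (@wave_continuous R h t b n k) (@wave_continuous R h t' b n' k'))).
  by move=> /has_integral_eq; apply => // p; rewrite mulrA.
by congr (_ * _ + _ * _); apply: has_integral_val; exact: i.
Qed.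

(** Modes with different frequencies or parity are orthogonal componentwise.  Two
    modes sharing them are a gradient and a divergence-free field with n, k > 0;
    their two components then have equal norms, and the amplitudes are orthogonal
    vectors. *)
Lemma mode_orthogonal j j' : nontrivial j -> nontrivial j' -> j != j' ->
  dot h (mode_field j) (mode_field j') = 0.
Proof.
case: j j' => [[[c s] n] k] [[[c' s'] n'] k'] nj nj' ne; rewrite dot_modes.
have [e|ne'] := eqVneq (s, n, k) (s', n', k'); last first.
  rewrite (wave_orthogonal h h0 _ _ false) // (wave_orthogonal h h0 _ _ true) ?mulr0 ?addr0 //.
  by apply: contra ne' => /eqP[/(inv_inj negbK) -> -> ->].
case: e ne nj' => <- <- <- ne nj'.
have cc : c' = ~~ c by case: (c) (c') ne => -[] //; rewrite eqxx.
have [n0 k0] : (0 < n)%N /\ (0 < k)%N.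
  move: nj nj'; rewrite cc /nontrivial /=.
  by case: (c); case: (n); case: (k); case: (s) => //=.
rewrite (wave_norm_flip0 h h0 s true) // (wave_norm_flip1 h h0 s false) // cc /=.
by rewrite (gtn_eqF n0) /=; case: (c) => /=; ring.
Qed.

Lemma mode_norm_gt0 j : nontrivial j -> 0 < dot h (mode_field j) (mode_field j).
Proof.
case: j => [[[c s] n] k] nj; rewrite dot_modes !mulrA -!expr2.
have Q0 t b : 0 <= pairing h (wave h t b n k) (wave h t b n k).
  by apply: Rintegral_ge0 => p _; rewrite -expr2 sqr_ge0.
have pos (x y : R) : x != 0 -> 0 < y -> 0 < x ^+ 2 * y.
  by move=> x0 y0; rewrite mulr_gt0 // lt_neqAle sqr_ge0 eq_sym sqrf_eq0 x0.
have k_neq0 : (0 < k)%N -> kap h k != 0 by move=> k0; rewrite gt_eqF // kap_gt0.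
have Qp t b : (0 < n)%N || ~~ t -> (0 < k)%N || ~~ b ->
    0 < pairing h (wave h t b n k) (wave h t b n k) by exact: wave_norm_gt0.
have sn (t : bool) : (0 < n)%N -> sg t * n%:R != 0 :> R.
  by move=> n1; rewrite mulf_neq0 ?sg_neq0 // pnatr_eq0 -lt0n.
have first (x y z w : R) : x != 0 -> 0 < y -> 0 <= w -> 0 < x ^+ 2 * y + z ^+ 2 * w.
  by move=> x0 y0 w0; apply: ltr_wpDr; [rewrite mulr_ge0 ?sqr_ge0|exact: pos].
have second (x y z w : R) : z != 0 -> 0 < w -> 0 <= y -> 0 < x ^+ 2 * y + z ^+ 2 * w.
  by move=> x0 y0 w0; apply: ltr_wpDl; [rewrite mulr_ge0 ?sqr_ge0|exact: pos].
move: nj; rewrite /nontrivial /amplitude0 /amplitude1; case: c.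
  move=> nk; apply: first => //.
    case: ifP => [_|H]; first exact: oner_neq0.
    apply: k_neq0; move: nk H.
    by case: (n) => [|?]; case: (k) => [|?] //=; rewrite ?andbF.
  by apply: Qp; rewrite ?orbT //; move: nk; case: (n) => [|?] //=.
case: (posnP n) => [n0 /= /andP[s1 k1]|n1 _].
  by apply: second => //; [exact: k_neq0|apply: Qp; rewrite ?k1 // s1 orbT].
by apply: first => //; [exact: sn|apply: Qp; rewrite ?n1 ?orbT].
Qed.

Lemma has_integral_sum (I : Type) (r : seq I) (c : I -> R) (f : I -> R * R -> R) (v : I -> R) :
  (forall i, has_integral h (f i) (v i)) ->
  has_integral h (fun p => \sum_(i <- r) c i * f i p) (\sum_(i <- r) c i * v i).
Proof.
move=> fv; elim: r => [|i r IH].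
  have := has_integralZ 0 (has_integral_self (integrableM2 h _ _ h0
    (@wave_continuous R h true true 0 0) (@wave_continuous R h true true 0 0))).
  by move=> /has_integral_eq; apply => [p|]; rewrite big_nil mul0r.
have := has_integralD (has_integralZ (c i) (fv i)) IH.
by move=> /has_integral_eq; apply => [p|]; rewrite big_cons.
Qed.

Lemma dot_has_integral u v : (forall a, cyl_integrable h (u a)) ->
  (forall a, continuous (v a)) ->
  has_integral h (fun p => \sum_(a < 2) u a p * v a p) (dot h u v).
Proof.
move=> iu cv; have i a := has_integral_self (cyl_integrableM_continuous h _ _ (iu a) (cv a)).
have H := has_integralD (i 0) (i 1).
have e : (fun p => u 0 p * v 0 p + u 1 p * v 1 p) = fun p => \sum_(a < 2) u a p * v a p.
  by apply/funext => p; rewrite sum2.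
by rewrite e in H; case: H => H _; exact: has_integral_self.
Qed.

Lemma dot_combination (I : Type) (r : seq I) (c : I -> R) (e : I -> vfield) v :
  (forall i a, cyl_integrable h (e i a)) -> (forall a, continuous (v a)) ->
  dot h (fun a p => \sum_(i <- r) c i * e i a p) v = \sum_(i <- r) c i * dot h (e i) v.
Proof.
move=> ie cv; apply: has_integral_val.
have := has_integral_sum _ r c _ _ (fun i => dot_has_integral (e i) v (ie i) cv).
move=> /has_integral_eq; apply => // p; rewrite sum2 !mulr_suml -big_split /=.
by apply: eq_bigr => i _; rewrite sum2 mulrDr !mulrA.
Qed.

Lemma combination_integrable (I : Type) (r : seq I) (c : I -> R) (e : I -> vfield) a :
  (forall i a, cyl_integrable h (e i a)) ->
  cyl_integrable h (fun p => \sum_(i <- r) c i * e i a p).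
Proof.
move=> ie.
by have [] := has_integral_sum _ r c _ _ (fun i => has_integral_self (ie i a)).
Qed.

Lemma dotB u w v : (forall a, cyl_integrable h (u a)) -> (forall a, cyl_integrable h (w a)) ->
  (forall a, continuous (v a)) ->
  dot h (fun a p => u a p - w a p) v = dot h u v - dot h w v.
Proof.
move=> iu iw cv; apply: has_integral_val.
have := has_integralD (dot_has_integral u v iu cv) (has_integralZ (-1) (dot_has_integral w v iw cv)).
move=> /has_integral_eq; apply => [p|]; last by rewrite mulN1r.
by rewrite !sum2; ring.
Qed.

Lemma dot_ae0 w v : (forall a, cyl_integrable h (w a)) -> (forall a, continuous (v a)) ->
  ae_eq_vfield h w (fun _ _ => 0) -> dot h w v = 0.
Proof.
move=> iw cv w0; have [iwv _] := dot_has_integral w v iw cv.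
have mC := @measurable_cylinder R h.
rewrite /dot /cyl_integral /Rintegral (_ : integral _ _ _ = 0%E) //.
rewrite -(integral0 lebesgue2 (cylinder h)).
apply: (ae_eq_integral _ _ mC) => //; first exact: (measurable_int _ iwv).
move: (w0 0) (w0 1); apply: filterS2 => p + + Cp => /(_ Cp) e0 /(_ Cp) e1.
by rewrite sum2 e0 e1 !mul0r addr0.
Qed.

Let integral_eq0 f g : g = (fun=> 0) -> cyl_integral h (fun p => f p * g p) = 0.
Proof. by move=> ->; exact: pairing0. Qed.

(** Orthogonality to the modes is turned into orthogonality of each component to
    its waves: for n, k > 0 the gradient and the divergence-free amplitudes form an
    invertible matrix of determinant - |xi|^2, and when n or k is 0 at least
    one of the two waves is zero, and the other, if it is not, is paired by a single
    mode. *)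
Lemma modes_complete w : (forall a, cyl_integrable h (w a)) ->
  (forall j, nontrivial j -> dot h w (mode_field j) = 0) ->
  ae_eq_vfield h w (fun _ _ => 0).
Proof.
move=> iw wj.
suff H s n k : cyl_integral h (fun p => w 0 p * wave h s false n k p) = 0 /\
    cyl_integral h (fun p => w 1 p * wave h (~~ s) true n k p) = 0.
  elim/ord2P.
    by apply: orthogonal_cos_eq0 => // s n k; have [] := H s n k.
  apply: orthogonal_sin_eq0 => // s n k.
  by have [_] := H (~~ s) n k; rewrite negbK.
have D c : nontrivial (c, s, n, k) ->
    amplitude0 (c, s, n, k) * cyl_integral h (fun p => w 0 p * wave h s false n k p) +
    amplitude1 (c, s, n, k) * cyl_integral h (fun p => w 1 p * wave h (~~ s) true n k p) = 0.
  by move=> nj; rewrite -dot_field //; exact: (wj (c, s, n, k)).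
move: D; set a := cyl_integral h _; set b := cyl_integral h _ => D.
have k_neq0 : (0 < k)%N -> kap h k != 0 by move=> k0; rewrite gt_eqF // kap_gt0.
have sn : (0 < n)%N -> sg s * n%:R != 0 :> R.
  by move=> n1; rewrite mulf_neq0 ?sg_neq0 // pnatr_eq0 -lt0n.
(* The waves that vanish identically contribute zero coefficients. *)
have b0 : k = 0%N \/ (n = 0%N /\ s = false) -> b = 0.
  move=> H; apply: integral_eq0; case: H => [->|[-> ->]]; first exact: wave_sink0.
  exact: wave_sin0.
have a0 : n = 0%N -> s = true -> a = 0.
  by move=> n0 s1; apply: integral_eq0; rewrite n0 s1; exact: wave_sin0.
have cancel (x y : R) : x != 0 -> x * y = 0 -> y = 0.
  by move=> x0 /eqP; rewrite mulf_eq0 (negbTE x0) => /eqP.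
have [n0|n1] := posnP n; last first.
  have := D false; rewrite /nontrivial /= n1 => /(_ isT) D1.
  have [k0|k1] := posnP k.
    have bz : b = 0 by apply: b0; left.
    by split => //; move: D1; rewrite bz mulr0 addr0; apply: cancel; exact: sn.
  have := D true; rewrite /nontrivial /= n1 k1 (gtn_eqF n1) => /(_ isT) D2.
  have pos : (sg s * n%:R) ^+ 2 + kap h k ^+ 2 != 0.
    by rewrite gt_eqF // ltr_wpDl ?sqr_ge0 // lt_neqAle sqr_ge0 eq_sym sqrf_eq0 k_neq0.
  split; apply: (cancel _ _ pos).
    transitivity (sg s * n%:R * (sg s * n%:R * a + kap h k * b) +
      kap h k * (kap h k * a + - (sg s * n%:R) * b)).
      by ring.
    by rewrite D1 D2 !mulr0 addr0.
  transitivity (kap h k * (sg s * n%:R * a + kap h k * b) -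
    sg s * n%:R * (kap h k * a + - (sg s * n%:R) * b)).
    by ring.
  by rewrite D1 D2 !mulr0 subr0.
have [s1|s0] := boolP s.
  have az : a = 0 by exact: a0.
  have [k0|k1] := posnP k; first by split => //; apply: b0; left.
  have := D false; rewrite /nontrivial /= s1 k1 orbT => /(_ isT) D1.
  by split => //; move: D1; rewrite az mulr0 add0r; apply: cancel; exact: k_neq0.
have bz : b = 0 by apply: b0; right; split => //; exact: negbTE.
split => //; have := D true; rewrite /nontrivial /= n0 s0 eqxx orbT => /(_ isT).
rewrite bz mulr0 addr0; apply: cancel; case: ifP => [_|/negbT k0]; first exact: oner_neq0.
by apply: k_neq0; rewrite lt0n.
Qed.

Lemma mode_integrable j a : cyl_integrable h (mode_field j a).
Proof. exact/square_integrable_integrable/mode_square_integrable. Qed.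

(** The modes of eigenvalue L are independent since they are orthogonal and
    nonzero.  A solution minus its projection on their span is orthogonal to these
    modes by construction and to all the others by [solution_orthogonal_mode]. *)
Lemma multiplicity_of_modes (L : R) (js : seq mode) : uniq js ->
  (forall j, (j \in js) = nontrivial j && (mode_eigenvalue j == L)) ->
  FD_multiplicity h lam mu L (size js).
Proof.
move=> ujs mem_js; set m := size js.
pose t : m.-tuple mode := in_tuple js.
pose e (i : 'I_m) := mode_field (tnth t i).
have t_js i : nontrivial (tnth t i) /\ mode_eigenvalue (tnth t i) = L.
  by have := mem_tnth i t; rewrite mem_js => /andP[-> /eqP ->].
have t_inj i i' : i != i' -> tnth t i != tnth t i'.
  apply: contra => /eqP tt; apply/eqP/val_inj/eqP.
  rewrite -(nth_uniq (tnth t i) _ _ ujs) ?ltn_ord //.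
  by rewrite -!(tnth_nth _ t) tt.
have ie i a : cyl_integrable h (e i a) by exact: mode_integrable.
have ce i a : continuous (e i a) by exact: mode_field_continuous.
have comb_dot (c : 'I_m -> R) i :
    dot h (fun a p => \sum_(i < m) c i * e i a p) (e i) = c i * dot h (e i) (e i).
  rewrite dot_combination // (bigD1 i) //= big1 ?addr0 // => i' ii'.
  by rewrite mode_orthogonal ?mulr0 ?t_inj //; [have [] := t_js i'|have [] := t_js i].
have norm_gt0 i : 0 < dot h (e i) (e i).
  by apply: mode_norm_gt0; have [] := t_js i.
exists e; split.
- move=> i; have [_ <-] := t_js i; exact: mode_solution.
- move=> c c0 i; apply/eqP; have := comb_dot c i.
  rewrite dot_ae0 // => [/esym/eqP|a]; last exact: combination_integrable.
  by rewrite mulf_eq0 (gt_eqF (norm_gt0 i)) orbF.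
- move=> u su; have [Du [[su2 _ _] _ _ _]] := su.
  have iu a : cyl_integrable h (u a) by exact: square_integrable_integrable.
  pose c i := dot h u (e i) / dot h (e i) (e i); exists c.
  pose v a p := \sum_(i < m) c i * e i a p.
  have iv a : cyl_integrable h (v a) by exact: combination_integrable.
  have : ae_eq_vfield h (fun a p => u a p - v a p) (fun _ _ => 0).
    apply: modes_complete => [a|j nj].
      have := has_integralD (has_integral_self (iu a)) (has_integralZ (-1) (has_integral_self (iv a))).
      move=> [+ _]; congr (cyl_integrable h _).
      by apply/funext => p; rewrite mulN1r.
    rewrite dotB //; last by move=> a; exact: mode_field_continuous.
    have [jL|jL] := eqVneq (mode_eigenvalue j) L.
      have jt : j \in t by rewrite mem_js nj jL eqxx.
      move: jt => /tnthP[i ji].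
      have -> : mode_field j = e i by rewrite ji.
      by rewrite comb_dot /c divfK ?subrr // gt_eqF.
    rewrite (solution_orthogonal_mode _ _ _ su jL) dot_combination //; last first.
      by move=> a; exact: mode_field_continuous.
    rewrite big1 ?subr0 // => i _; rewrite mode_orthogonal ?mulr0 //; first by have [] := t_js i.
    by apply: contra jL => /eqP <-; have [_ ->] := t_js i.
  move=> uv a; apply: filterS (uv a) => p + Cp => /(_ Cp) /eqP.
  by rewrite subr_eq0 => /eqP.
Qed.

Lemma FD_eigenvalue_multiplicity (L : R) m : FD_multiplicity h lam mu L m ->
  FD_eigenvalue h lam mu L <-> (0 < m)%N.
Proof.
move=> [e [se ind span]]; split=> [[u su unz]|m0].
  rewrite lt0n; apply/negP => /eqP m0; subst m; apply: unz.
  have [c uc] := span u su => a; apply: filterS (uc a) => p + Cp => /(_ Cp) ->.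
  by rewrite big_ord0.
pose i0 : 'I_m := Ordinal m0; exists (e i0) => // e0.
have := ind (fun i => (i == i0)%:R) _ i0; rewrite eqxx => H.
suff /H /eqP : ae_eq_vfield h (fun a p => \sum_(i < m) (i == i0)%:R * e i a p) (fun _ _ => 0).
  by rewrite oner_eq0.
rewrite (_ : (fun a p => _) = e i0) //; apply/funext => a; apply/funext => p.
rewrite (bigD1 i0) // big1 => [|i /negbTE ->]; last by rewrite mul0r.
by rewrite /= addr0 mul1r.
Qed.

(** The factors mu and lam + 2 mu are positive, so a given value is taken for
    finitely many frequencies only; this makes the lists of modes finite. *)
Lemma eigenvalue_bound (L : R) : exists N : nat, forall (n k : nat) (c : R),
  c = mu \/ c = lam + 2 * mu -> (n%:R ^+ 2 + kap h k ^+ 2) * c = L -> (n <= N)%N /\ (k <= N)%N.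
Proof.
have l2m : 0 < lam + 2 * mu by move: mu0 lm0 => *; lra.
have kap1 := kap_gt0 h h0 1 isT.
set X := `|L| / mu + `|L| / (lam + 2 * mu).
have X0 : 0 <= X by rewrite addr_ge0 // divr_ge0 // ltW.
have Y0 : 0 <= X / kap h 1 ^+ 2 by rewrite divr_ge0 ?sqr_ge0.
have [N _ /(_ N (leqnn N)) /= HN] := @nbhs_infty_ger R (X + X / kap h 1 ^+ 2).
have square_ge (m : nat) : m%:R <= m%:R ^+ 2 :> R.
  by rewrite -natrX ler_nat; case: m => // m; rewrite -mulnn leq_pmulr.
exists N => n k c cc nkL.
have c0 : 0 < c by case: cc => ->.
have nkX : n%:R ^+ 2 + kap h k ^+ 2 <= X.
  have -> : n%:R ^+ 2 + kap h k ^+ 2 = L / c by rewrite -nkL mulfK ?gt_eqF.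
  have Lc : L / c <= `|L| / c by rewrite ler_wpM2r ?ler_norm // invr_ge0 ltW.
  apply: (le_trans Lc); rewrite /X; case: cc => ->.
    by rewrite lerDl divr_ge0 // ltW.
  by rewrite lerDr divr_ge0 // ltW.
have kE : kap h k ^+ 2 = k%:R ^+ 2 * kap h 1 ^+ 2.
  by rewrite -exprMn /kap; congr (_ ^+ 2); rewrite mul1r mulrA.
have kX : k%:R ^+ 2 <= X / kap h 1 ^+ 2.
  rewrite ler_pdivlMr ?exprn_gt0 // -kE; apply: le_trans nkX.
  by rewrite lerDr sqr_ge0.
have nX : n%:R ^+ 2 <= X by apply: le_trans nkX; rewrite lerDl sqr_ge0.
by split; rewrite -(ler_nat R); apply: (le_trans (square_ge _)); apply: le_trans HN; lra.
Qed.

End ModeBasis.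

(** * Counting *)

Lemma card_uniq_seq (T : eqType) (x0 : T) (A : set T) (r : seq T) : uniq r ->
  (forall x, A x <-> x \in r) -> (A #= `I_(size r))%card.
Proof.
move=> ur Ar; rewrite (_ : A = nth x0 r @` `I_(size r)).
  apply: inj_card_eq => i j; rewrite !inE /= => ir jr /eqP.
  by rewrite nth_uniq // => /eqP.
apply/seteqP; split=> [x /Ar xr|_ [i ir <-]]; last exact/Ar/mem_nth.
by exists (index x r); [rewrite /= index_mem|rewrite nth_index].
Qed.

(** A labelling separates the two lists; it is how the five series are kept
    apart. *)
Lemma uniq_cat_disjoint (T U : eqType) (f : T -> U) (a : U) (r r' : seq T) :
  uniq r -> uniq r' -> {in r, forall x, f x = a} -> {in r', forall x, f x != a} ->
  uniq (r ++ r').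
Proof.
move=> ur ur' fr fr'; rewrite cat_uniq ur ur' andbT /=.
by apply/hasPn => x /fr'; apply: contra => /= /fr ->.
Qed.

(** * The spectrum *)

Theorem theorem3p2 (R : realType) (h lam mu : R)
    (h_gt0 : 0 < h) (mu_gt0 : 0 < mu) (lam_mu_gt0 : 0 < lam + mu) :
  (forall Lambda : R, Lambda != 0 ->
    exists m1 m2 m3 m4 m5 : nat,
    [/\ occurs1 (fun k => k%:R ^+ 2 * pi ^+ 2 / h ^+ 2 * (lam + 2 * mu)) Lambda m1,
        occurs1 (fun k => k%:R ^+ 2 * pi ^+ 2 / h ^+ 2 * mu) Lambda m2,
        occurs2 (fun n k => (n%:R ^+ 2 + k%:R ^+ 2 * pi ^+ 2 / h ^+ 2) * mu)
          Lambda m3,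
        occurs1 (fun n => n%:R ^+ 2 * (lam + 2 * mu)) Lambda m4 &
        occurs2 (fun n k => (n%:R ^+ 2 + k%:R ^+ 2 * pi ^+ 2 / h ^+ 2)
          * (lam + 2 * mu)) Lambda m5] /\
    let m := (m1 + m2 + 2 * m3 + 2 * m4 + 2 * m5)%N in
    (FD_eigenvalue h lam mu Lambda <-> (0 < m)%N) /\
    FD_multiplicity h lam mu Lambda m) /\
  FD_multiplicity h lam mu 0 1.
Proof.
have l2m : 0 < lam + 2 * mu by lra.
have kapE k : kap h k ^+ 2 = k%:R ^+ 2 * pi ^+ 2 / h ^+ 2 by rewrite /kap expr_div_n exprMn.
have kap00 : kap h 0 = 0 by rewrite kap0.
split=> [L L0|]; last first.
  apply: (multiplicity_of_modes h lam mu h_gt0 0 [:: (true, false, 0, 0)%N]) => //.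
  move=> [[[c s] n] k]; rewrite inE; apply/eqP/andP => [[-> -> -> ->]|[+ /eqP]].
    by split => //=; rewrite kap00 expr0n addr0 mul0r.
  move=> nj /eqP; rewrite /mode_eigenvalue mulf_eq0 [X in _ || X]gt_eqF ?orbF; last by case: (c).
  rewrite paddr_eq0 ?sqr_ge0 // !sqrf_eq0 pnatr_eq0 => /andP[/eqP n0 k0].
  have {}k0 : k = 0%N by apply: (kap_inj h h_gt0); rewrite kap00; apply/eqP.
  by move: nj; rewrite n0 k0; case: (c) (s) => -[].
have [N HN] := eigenvalue_bound h lam mu h_gt0 mu_gt0 lam_mu_gt0 L.
pose I := iota 1 N; pose II := [seq (n, k) | n <- I, k <- I].
have memI n : (n \in I) = (0 < n <= N)%N by rewrite mem_iota add1n ltnS.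
have memII n k : ((n, k) \in II) = (n \in I) && (k \in I).
  apply/allpairsP/andP => [[[n' k'] [? ? [-> ->]]] //|[nI kI]].
  by exists (n, k).
have uI : uniq I by exact: iota_uniq.
have uII : uniq II by apply: allpairs_uniq => // -[? ?] [? ?] _ _ [-> ->].
pose f1 (c : R) k := k%:R ^+ 2 * pi ^+ 2 / h ^+ 2 * c.
pose f2 (c : R) n k := (n%:R ^+ 2 + k%:R ^+ 2 * pi ^+ 2 / h ^+ 2) * c.
pose f3 (c : R) n := n%:R ^+ 2 * c.
have f2E c n k : f2 c n k = (n%:R ^+ 2 + kap h k ^+ 2) * c by rewrite kapE.
have f1E c k : f1 c k = f2 c 0%N k by rewrite /f1 /f2 expr0n add0r.
have f3E c n : f3 c n = f2 c n 0%N by rewrite /f3 /f2 expr0n !mul0r addr0.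
pose ok (c : R) := c = mu \/ c = lam + 2 * mu.
have okm : ok mu by left.
have okl : ok (lam + 2 * mu) by right.
have bound c n k : ok c -> f2 c n k == L -> (n <= N)%N && (k <= N)%N.
  by rewrite f2E => cc /eqP /(HN _ _ _ cc) [-> ->].
pose s1 c := [seq k <- I | f1 c k == L].
pose s2 c := [seq p <- II | f2 c p.1 p.2 == L].
pose s3 c := [seq n <- I | f3 c n == L].
have mem1 c k : ok c -> (k \in s1 c) = (0 < k)%N && (f2 c 0 k == L).
  move=> cc; rewrite mem_filter memI f1E andbC; case: eqP => [/eqP e|]; last by rewrite !andbF.
  by have /andP[_ ->] := bound _ _ _ cc e; rewrite andbT.
have mem3 c n : ok c -> (n \in s3 c) = (0 < n)%N && (f2 c n 0 == L).
  move=> cc; rewrite mem_filter memI f3E andbC; case: eqP => [/eqP e|]; last by rewrite !andbF.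
  by have /andP[-> _] := bound _ _ _ cc e; rewrite andbT.
have mem2 c n k : ok c -> ((n, k) \in s2 c) = [&& (0 < n)%N, (0 < k)%N & f2 c n k == L].
  move=> cc; rewrite mem_filter memII !memI andbC /=; case: eqP => [/eqP e|]; last by rewrite !andbF.
  by have /andP[-> ->] := bound _ _ _ cc e; rewrite !andbT.
have u1 c : uniq (s1 c) by exact: filter_uniq.
have u2 c : uniq (s2 c) by exact: filter_uniq.
have u3 c : uniq (s3 c) by exact: filter_uniq.
pose bb := [:: false; true].
pose l := lam + 2 * mu.
(* The modes of the five series.  For n > 0 both parities in x1 occur, which gives
   the multiplicity 2; for n = 0 the sine in x1 vanishes, and one parity is left. *)
pose P1 : seq mode := [seq (false, true, 0%N, k) | k <- s1 l].
pose P2 : seq mode := [seq (true, false, 0%N, k) | k <- s1 mu].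
pose P3 : seq mode := [seq (true, b, p.1, p.2) | b <- bb, p <- s2 mu].
pose P4 : seq mode := [seq (false, b, n, 0%N) | b <- bb, n <- s3 l].
pose P5 : seq mode := [seq (false, b, p.1, p.2) | b <- bb, p <- s2 l].
have memP1 c s n k : ((c, s, n, k) \in P1) = [&& ~~ c, s, n == 0%N & k \in s1 l].
  apply/mapP/and4P => [[k' ks [-> -> -> ->]] //|[/negbTE -> -> /eqP -> ks]].
  by exists k.
have memP2 c s n k : ((c, s, n, k) \in P2) = [&& c, ~~ s, n == 0%N & k \in s1 mu].
  apply/mapP/and4P => [[k' ks [-> -> -> ->]] //|[-> /negbTE -> /eqP -> ks]].
  by exists k.
have memP3 c s n k : ((c, s, n, k) \in P3) = c && ((n, k) \in s2 mu).
  apply/allpairsP/andP => [[[b [n' k']] [/= _ ps [-> _ -> ->]]] //|[-> ps]].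
  by exists (s, (n, k)); split => //; case: (s).
have memP4 c s n k : ((c, s, n, k) \in P4) = [&& ~~ c, n \in s3 l & k == 0%N].
  apply/allpairsP/and3P => [[[b n'] [/= _ ns [-> _ -> ->]]] //|[/negbTE -> ns /eqP ->]].
  by exists (s, n); split => //; case: (s).
have memP5 c s n k : ((c, s, n, k) \in P5) = ~~ c && ((n, k) \in s2 l).
  apply/allpairsP/andP => [[[b [n' k']] [/= _ ps [-> _ -> ->]]] //|[/negbTE -> ps]].
  by exists (s, (n, k)); split => //; case: (s).
pose js := P1 ++ P2 ++ P3 ++ P4 ++ P5.
have mem_js j : (j \in js) = nontrivial j && (mode_eigenvalue h lam mu j == L).
  case: j => [[[c s] n] k]; rewrite mem_cat memP1 mem_cat memP2 mem_cat memP3 mem_cat memP4 memP5.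
  rewrite !mem1 // !mem2 // mem3 // /mode_eigenvalue -f2E /nontrivial.
  have z c' : (f2 c' 0%N 0%N == L) = false.
    by rewrite f2E kap00 !expr0n addr0 mul0r eq_sym (negbTE L0).
  by case: c; case: s; case: n => [|n]; case: k => [|k]; rewrite /= ?z ?andbF ?orbF ?andbT.
(* The series to which a nontrivial mode belongs. *)
pose cl (j : mode) : nat := let: (c, s, n, k) := j in
  if c then (if n == 0 then 2 else 3)%N else (if n == 0 then 1 else if k == 0 then 4 else 5)%N.
have c1 : {in P1, forall j, cl j = 1%N}.
  by move=> [[[c s] n] k]; rewrite memP1 => /and4P[/negbTE -> _ /eqP -> _].
have c2 : {in P2, forall j, cl j = 2%N}.
  by move=> [[[c s] n] k]; rewrite memP2 => /and4P[-> _ /eqP -> _].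
have c3 : {in P3, forall j, cl j = 3%N}.
  by move=> [[[c s] n] k]; rewrite memP3 mem2 // => /andP[-> /and3P[]]; rewrite /= lt0n => /negbTE ->.
have c4 : {in P4, forall j, cl j = 4%N}.
  move=> [[[c s] n] k]; rewrite memP4 mem3 // => /and3P[/negbTE -> /andP[+ _] /eqP ->].
  by rewrite /= lt0n => /negbTE ->.
have c5 : {in P5, forall j, cl j = 5%N}.
  move=> [[[c s] n] k]; rewrite memP5 mem2 // => /andP[/negbTE -> /and3P[]].
  by rewrite /= !lt0n => /negbTE -> /negbTE ->.
have ujs : uniq js.
  apply: (uniq_cat_disjoint _ _ cl 1%N) => //.
  - by rewrite map_inj_uniq // => ? ? [].
  - apply: (uniq_cat_disjoint _ _ cl 2%N) => //.
    + by rewrite map_inj_uniq // => ? ? [].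
    + apply: (uniq_cat_disjoint _ _ cl 3%N) => //.
      * by apply: allpairs_uniq => // -[? [? ?]] [? [? ?]] _ _ /= [-> -> ->].
      * apply: (uniq_cat_disjoint _ _ cl 4%N) => //.
        - by apply: allpairs_uniq => // -[? ?] [? ?] _ _ /= [-> ->].
        - by apply: allpairs_uniq => // -[? [? ?]] [? [? ?]] _ _ /= [-> -> ->].
        - by move=> j /c5 ->.
      * by move=> j; rewrite mem_cat => /orP[/c4 ->|/c5 ->].
    + by move=> j; rewrite mem_cat => /orP[/c3 -> //|]; rewrite mem_cat => /orP[/c4 ->|/c5 ->].
  - move=> j; rewrite mem_cat => /orP[/c2 -> //|]; rewrite mem_cat => /orP[/c3 -> //|].
    by rewrite mem_cat => /orP[/c4 ->|/c5 ->].
exists (size (s1 l)), (size (s1 mu)), (size (s2 mu)), (size (s3 l)), (size (s2 l)).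
have occ1 c : ok c -> occurs1 (f1 c) L (size (s1 c)).
  move=> cc; apply: (card_uniq_seq _ 0%N) => // k; rewrite mem1 // -f1E.
  by split=> [[k0 fk]|/andP[k0 /eqP fk] //]; rewrite k0 fk eqxx.
have occ3 c : ok c -> occurs1 (f3 c) L (size (s3 c)).
  move=> cc; apply: (card_uniq_seq _ 0%N) => // k; rewrite mem3 // -f3E.
  by split=> [[k0 fk]|/andP[k0 /eqP fk] //]; rewrite k0 fk eqxx.
have occ2 c : ok c -> occurs2 (f2 c) L (size (s2 c)).
  move=> cc; apply: (card_uniq_seq _ (0%N, 0%N)) => // -[n k]; rewrite mem2 //=.
  by split=> [[n0 k0 fk]|/and3P[n0 k0 /eqP fk] //]; rewrite n0 k0 fk eqxx.
split; first by split; [exact: occ1|exact: occ1|exact: occ2|exact: occ3|exact: occ2].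
move=> m; have -> : m = size js.
  have e1 : size P1 = size (s1 l) by exact: size_map.
  have e2 : size P2 = size (s1 mu) by exact: size_map.
  have e3 : size P3 = (2 * size (s2 mu))%N by exact: size_allpairs.
  have e4 : size P4 = (2 * size (s3 l))%N by exact: size_allpairs.
  have e5 : size P5 = (2 * size (s2 l))%N by exact: size_allpairs.
  by rewrite /js size_cat (size_cat P2) (size_cat P3) (size_cat P4) e1 e2 e3 e4 e5 /m !addnA.
have Mu := multiplicity_of_modes h lam mu h_gt0 L js ujs mem_js.
split => //; exact: (FD_eigenvalue_multiplicity h lam mu L _ Mu).
Qed.
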